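(* Let $\mathscr{S}\colon\mathscr{C}_{\mathrm{lin}}^{\mathrm{reg}}(A)\to\mathbb{R}$ and $\mathscr{S}_0\colon\mathscr{C}_{\mathrm{anis}}(A)\to\mathbb{R}$ be functionals. There is a natural way to define the restriction of $\mathscr{S}$ to $\mathscr{C}_{\mathrm{anis}}(A)$, namely $$\mathscr{S}|_{\mathscr{C}_{\mathrm{anis}}}\colon\mathscr{C}_{\mathrm{anis}}(A)\to\mathbb{R},\qquad\mathscr{S}|_{\mathscr{C}_{\mathrm{anis}}}[\Gamma]:=\mathscr{S}[\varrho\Gamma],$$ and one to extend $\mathscr{S}_0$ to $\mathscr{C}_{\mathrm{lin}}^{\mathrm{reg}}(A)$, namely $$\mathscr{S}_1\colon\mathscr{C}_{\mathrm{lin}}^{\mathrm{reg}}(A)\to\mathbb{R},\qquad\mathscr{S}_1[\hat\nabla]:=\mathscr{S}_0[\jmath(\hat\nabla)].$$ Furthermore: (i) There is a natural modification of $\mathscr{S}$ defined by $$\tilde{\mathscr{S}}\colon\mathscr{C}_{\mathrm{lin}}^{\mathrm{reg}}(A)\to\mathbb{R},\qquad\tilde{\mathscr{S}}[\hat\nabla]:=\mathscr{S}|_{\mathscr{C}_{\mathrm{anis}}}[\jmath(\hat\nabla)]=\mathscr{S}[\varrho(\jmath(\hat\nabla))].$$ Under the identification $\hat\nabla\equiv(\jmath(\hat\nabla),\Delta)$ of $\mathscr{C}_{\mathrm{lin}}^{\mathrm{reg}}(A)$ with $\mathscr{C}_{\mathrm{anis}}(A)\times\{\Delta\in\mathrm{h}_{-1}\mathcal{T}^1_2(M_A):(\delta^i_j+\Delta^i_{jc}y^c)\text{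 invertible everywhere}\}$, this becomes a functional invariant under the maps $(\Gamma,\Delta)\mapsto(\Gamma,\Delta+\Delta')$ for every admissible $\Delta'$. (ii) If an auxiliary nonlinear connection $N\in\mathscr{C}_{\mathrm{nl}}(A)$ is given, one can extend $\mathscr{S}_0$ to $\mathscr{C}_{\mathrm{lin}}(A)$ in a different way: $$\mathscr{S}_{2,N}\colon\mathscr{C}_{\mathrm{lin}}(A)\to\mathbb{R},\qquad\mathscr{S}_{2,N}[\hat\nabla]:=\mathscr{S}_0[\jmath_N(\hat\nabla)].$$ Accordingly, the alternative modification of $\mathscr{S}$ $$\tilde{\mathscr{S}}_{2,N}\colon\mathscr{C}_{\mathrm{lin}}(A)\to\mathbb{R},\qquad\tilde{\mathscr{S}}_{2,N}[\hat\nabla]:=\mathscr{S}[\varrho(\jmath_N(\hat\nabla))],$$ becomes, under the identification $\mathscr{C}_{\mathrm{lin}}(A)\equiv\mathscr{C}_{\mathrm{anis}}(A)\times\mathrm{h}_{-1}\mathcal{T}^1_2(M_A)$ determined by $N$, a functional invariant under $(\Gamma,\Delta)\mapsto(\Gamma,\Delta+\Delta')$ for every $\Delta'\in\mathrm{h}_{-1}\mathcal{T}^1_2(M_A)$.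
   Context: A functional on a set $\mathscr{X}$ is any map $\mathscr{X}\to\mathbb{R}$. ''Restriction'' and ''extension'' are understood by regarding $\mathscr{C}_{\mathrm{anis}}(A)$ as a subset of $\mathscr{C}_{\mathrm{lin}}^{\mathrm{reg}}(A)\subset\mathscr{C}_{\mathrm{lin}}(A)$ through the injective map $\varrho$ below. ''Admissible'' $\Delta'$ means that $(\Gamma,\Delta+\Delta')$ still belongs to the indicated product set. $M$ is a smooth (Hausdorff, second countable) $n$-dimensional manifold and $A\subseteq \mathrm{T}M\setminus\mathbf{0}$ is open with every fiber $A_p:=A\cap \mathrm{T}_pM$ ($p\in M$) nonempty and conic (closed under multiplication by $\lambda\in\mathbb{R}^+=(0,\infty)$). $\pi_A\colon A\to M$ is the natural projection and $h_\lambda\colon A\to A$, $h_\lambda(v)=\lambda v$. All objects are smooth ($\mathcal{C}^\infty$). $\mathcal{T}^r_s(M_A)$ is the set of sections of $\pi_A^*(\mathrm{T}M^{\otimes r}\otimes\mathrm{T}^*M^{\otimes s})\to A$; $\mathrm{h}_\alpha\mathcal{T}^r_s(M_A)$ those whose components in natural coordinates $(x^i,y^i)$ of $\mathrm{T}M$ satisfy $T(x,\lambda y)=\lambda^\alpha T(x,y)$ for $\lambda\in\mathbb{R}^+$. A vector field $\mathcal{X}=\mathcal{X}_1^i\partial_{x^i}+\mathcal{X}_2^i\partial_{y^i}$ on $A$ is homogeneous of degree $\alpha$ if $\mathcal{X}_{\lambda v}=\lambda^\alpha\,\mathrm{d}(h_\lambda)_v(\mathcal{X}_v)$, i.e. $\mathcal{X}_1^i$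 is $\alpha$-homogeneous and $\mathcal{X}_2^i$ is $(\alpha+1)$-homogeneous; $\mathrm{h}_\alpha\mathfrak{X}(A)$ is the set of these. $\mathscr{C}_{\mathrm{nl}}(A)$: ($1$-homogeneous) nonlinear connections, i.e. assignments $v\in A\mapsto N_v\in\mathrm{Hom}(\mathrm{T}_{\pi(v)}M,\mathrm{T}_vA)$ with $\mathrm{d}(\pi_A)_v\circ N_v=\mathrm{Id}$ and $N_{\lambda v}=\mathrm{d}(h_\lambda)_v\circ N_v$; locally $N=(\delta^i_j\partial_{x^i}-N^i_j\partial_{y^i})\otimes\mathrm{d}x^j$. Put $\delta_{x^i}:=\partial_{x^i}-N^a_i\partial_{y^a}$. $\mathscr{C}_{\mathrm{anis}}(A)$: ($0$-homogeneous) anisotropic connections, i.e. sections of $\pi_A^*(\mathrm{C}M)\to A$ invariant under $v\mapsto\lambda v$, where $\mathrm{C}M\to M$ is the bundle whose sections are the affine connections on $M$; locally given by $0$-homogeneous functions $\Gamma^i_{jk}$ on $A\cap\mathrm{T}U$ transforming as classical Christoffel symbols. $\mathscr{C}_{\mathrm{lin}}(A)$: homogeneous linear connections $\hat\nabla$ on $\pi_A^*(\mathrm{T}M)\to A$, i.e. Koszul connections $\hat\nabla\colon\mathfrak{X}(A)\times\mathcal{T}^1_0(M_A)\to\mathcal{T}^1_0(M_A)$ restricting to $\mathrm{h}_\alpha\mathfrak{X}(A)\times\mathrm{h}_\beta\mathcal{T}^1_0(M_A)\to\mathrm{h}_{\alpha+\beta}\mathcal{T}^1_0(M_A)$ for all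 $\alpha,\beta\in\mathbb{R}$. Coefficients: $(\hat\Gamma^1)^i_{jk}\partial_{x^i}:=\hat\nabla_{\partial_{x^j}}\partial_{x^k}$, $(\hat\Gamma^2)^i_{jk}\partial_{x^i}:=\hat\nabla_{\partial_{y^j}}\partial_{x^k}$. $\mathscr{C}_{\mathrm{lin}}^{\mathrm{reg}}(A)$ is the subset of regular ones, those for which the matrix $(\delta^i_j+(\hat\Gamma^2)^i_{jc}y^c)$ is invertible everywhere on $A$. Given $N\in\mathscr{C}_{\mathrm{nl}}(A)$, there is an identification $\mathscr{C}_{\mathrm{lin}}(A)\equiv\mathscr{C}_{\mathrm{anis}}(A)\times\mathrm{h}_{-1}\mathcal{T}^1_2(M_A)$, $\hat\nabla\equiv(\Gamma,\Delta)$, with $\Gamma^i_{jk}\partial_{x^i}:=\hat\nabla_{\delta_{x^j}}\partial_{x^k}$ and $\Delta^i_{jk}\partial_{x^i}:=\hat\nabla_{\partial_{y^j}}\partial_{x^k}$; put $\jmath_N(\hat\nabla):=\Gamma$. The injective map $\varrho\colon\mathscr{C}_{\mathrm{anis}}(A)\to\mathscr{C}_{\mathrm{lin}}(A)$ takes $\Gamma$ to the $\hat\nabla$ corresponding to $(\Gamma,0)$ (independent of $N$), i.e. $(\hat\Gamma^1)^i_{jk}=\Gamma^i_{jk}$, $(\hat\Gamma^2)^i_{jk}=0$; its image lies in $\mathscr{C}_{\mathrm{lin}}^{\mathrm{reg}}(A)$. The map $\jmath\colon\mathscr{C}_{\mathrm{lin}}^{\mathrm{reg}}(A)\to\mathscr{C}_{\mathrm{anis}}(A)$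 is $\jmath(\hat\nabla):=\jmath_N(\hat\nabla)$ for $N^a_i=B^a_b(\hat\Gamma^1)^b_{ic}y^c$, where $(B^i_j)=(\delta^i_j+(\hat\Gamma^2)^i_{jc}y^c)^{-1}$; that is, $\jmath(\hat\nabla)^i_{jk}=(\hat\Gamma^1)^i_{jk}-B^b_a(\hat\Gamma^1)^a_{jc}y^c(\hat\Gamma^2)^i_{bk}$. The assignment $\hat\nabla\mapsto(\jmath(\hat\nabla),\Delta)$, $\Delta^i_{jk}=(\hat\Gamma^2)^i_{jk}$, is a bijection from $\mathscr{C}_{\mathrm{lin}}^{\mathrm{reg}}(A)$ onto $\mathscr{C}_{\mathrm{anis}}(A)\times\{\Delta\in\mathrm{h}_{-1}\mathcal{T}^1_2(M_A):(\delta^i_j+\Delta^i_{jc}y^c)\text{ invertible everywhere}\}$, which is the identification used in (i). *)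

(* Defs.v *)
From HB Require Import structures.
From mathcomp Require Import all_boot all_order all_algebra.
From mathcomp Require Import all_classical all_reals all_analysis.
Set Implicit Arguments.
Unset Strict Implicit.
Unset Printing Implicit Defensive.
Import Order.TTheory GRing.Theory Num.Theory.
Import numFieldNormedType.Exports.
Local Open Scope classical_set_scope.
Local Open Scope ring_scope.

Section Smooth.
Context {R : realType} {V W : normedModType R}.

Fixpoint Ck (k : nat) (U : set V) (f : V -> W) : Prop :=
  if k is k'.+1 then
    (forall x, U x -> differentiable f x) /\
    (forall v, Ck k' U (fun x => 'D_v f x))
  else forall x, U x -> {for x, continuous f}.

(* Only used for open U, so that no value of f outside U matters. *)
Definition smooth_on (U : set V) (f : V -> W) : Prop := forall k, Ck k U f.

End Smooth.

Section Ck_lemmas.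
Context {R : realType} {V W : normedModType R}.

Lemma near_eq_differentiable (f g : V -> W) x :
  (\forall y \near x, f y = g y) -> differentiable f x -> differentiable g x.
Proof.
move=> fg /diff_locallyP[dfc dfE].
have gE : g \o shift x = cst (g x) + 'd f x +o_ 0 id.
  apply/eqaddoP => _/posnumP[e].
  move/eqaddoP: dfE => /(_ _ (gt0 e)) dfe.
  have fg0 : \forall h \near (0 : V), f (h + x) = g (h + x).
    by move: fg; rewrite (near_shift 0) subr0.
  near=> h.
  have -> : (g \o shift x - (cst (g x) + 'd f x)) h =
            (f \o shift x - (cst (f x) + 'd f x)) h.
    rewrite !fctE /= -(nbhs_singleton fg); congr (_ - _).
    by apply/esym; near: h; exact: fg0.
  by near: h.
have dg : 'd g x = 'd f x :> (V -> W) by exact: diff_unique.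
by apply/diff_locallyP; rewrite dg.
Unshelve. all: end_near. Qed.

Lemma Ck_eq k (U : set V) (f g : V -> W) : open U ->
  (forall x, U x -> f x = g x) -> Ck k U f -> Ck k U g.
Proof.
move=> oU; elim: k f g => [|k IH] f g fg /=.
  move=> cf x Ux; rewrite /prop_for /continuous_at -fg//.
  apply: cvg_trans (cf x Ux); apply: near_eq_cvg.
  by near do rewrite fg//; exact: open_nbhs_nbhs.
move=> [df Df]; split=> [x Ux|v].
  apply: near_eq_differentiable (df x Ux).
  by near do rewrite fg//; exact: open_nbhs_nbhs.
apply: IH (Df v) => x Ux; apply: near_eq_derive.
by near do rewrite fg//; exact: open_nbhs_nbhs.
Unshelve. all: end_near. Qed.

Lemma CkD k (U : set V) (f g : V -> W) : open U ->
  Ck k U f -> Ck k U g -> Ck k U (fun x => f x + g x).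
Proof.
move=> oU; elim: k f g => [|k IH] f g /=.
  by move=> cf cg x Ux; apply: cvgD; [exact: cf|exact: cg].
move=> [df Df] [dg Dg]; split=> [x Ux|v].
  exact: (differentiableD (df x Ux) (dg x Ux)).
apply: Ck_eq (IH _ _ (Df v) (Dg v)) => // x Ux.
by rewrite -deriveD//; apply: diff_derivable; [exact: df|exact: dg].
Qed.

End Ck_lemmas.

(* A smooth manifold is given by an atlas. [cinv c] inverts [cmap c] on the
   image of the chart; its values elsewhere are irrelevant. *)
Record manifold (R : realType) (n : nat) := Manifold {
  mpt :> topologicalType;
  chart : Type;
  cdom : chart -> set mpt;
  cmap : chart -> mpt -> 'rV[R]_n;
  cinv : chart -> 'rV[R]_n -> mpt;
  trans c d : 'rV[R]_n -> 'rV[R]_n := cmap d \o cinv c;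
  mpt_hausdorff : hausdorff_space mpt;
  mpt_second_countable : @second_countable mpt;
  cdom_open : forall c, open (cdom c);
  cdom_cover : forall p, exists c, cdom c p;
  cimg_open : forall c, open (cmap c @` cdom c);
  cmapK : forall c p, cdom c p -> cinv c (cmap c p) = p;
  cmap_continuous : forall c, {within cdom c, continuous (cmap c)};
  cinv_continuous : forall c, {within cmap c @` cdom c, continuous (cinv c)};
  trans_smooth : forall c d,
    smooth_on (cmap c @` (cdom c `&` cdom d)) (trans c d)
}.
Arguments cdom {R n m}.
Arguments cmap {R n m}.
Arguments cinv {R n m}.
Arguments trans {R n m}.

(* A tangent vector at p is the family of its coordinate vectors in the charts
   around p (the charts that miss p get the value 0, so that equality of
   vectors is Leibniz equality). *)
Record tangent_bundle (R : realType) (n : nat) (M : manifold R n) := TVec {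
  tpt : M;
  tco : chart M -> 'rV[R]_n;
  tco_out : forall c, ~ cdom c tpt -> tco c = 0;
  tco_trans : forall c d, cdom c tpt -> cdom d tpt ->
    tco d = 'd (trans c d) (cmap c tpt) (tco c)
}.

Section Scale.
Context {R : realType} {n : nat} {M : manifold R n}.

Lemma tscale_out (l : R) (v : tangent_bundle M) c :
  ~ cdom c (tpt v) -> l *: tco v c = 0.
Proof. by move=> /tco_out->; rewrite scaler0. Qed.

Lemma tscale_trans (l : R) (v : tangent_bundle M) c d :
  cdom c (tpt v) -> cdom d (tpt v) ->
  l *: tco v d = 'd (trans c d) (cmap c (tpt v)) (l *: tco v c).
Proof. by move=> vc vd; rewrite (tco_trans vc vd) linearZ. Qed.

Definition tscale (l : R) (v : tangent_bundle M) : tangent_bundle M :=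
  TVec (@tscale_out l v) (@tscale_trans l v).

(* Image of A in the natural coordinates (x, y) of TM over the chart c. *)
Definition natdom (A : set (tangent_bundle M)) (c : chart M) :
    set ('rV[R]_n * 'rV[R]_n) :=
  (fun v => (cmap c (tpt v), tco v c)) @` (A `&` [set v | cdom c (tpt v)]).

(* Change of natural coordinates of TM from c to d. *)
Definition ntrans (c d : chart M) (z : 'rV[R]_n * 'rV[R]_n) :
    'rV[R]_n * 'rV[R]_n :=
  (trans c d z.1, 'd (trans c d) (z.1) z.2).

Definition hscale (l : R) (z : 'rV[R]_n * 'rV[R]_n) : 'rV[R]_n * 'rV[R]_n :=
  (z.1, l *: z.2).

End Scale.

(* Openness in TM is tested in natural coordinates. *)
Record conic_dom (R : realType) (n : nat) (M : manifold R n) := ConicDom {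
  cd_set :> set (tangent_bundle M);
  cd_open : forall c, open (natdom cd_set c);
  cd_nonzero : forall v, cd_set v -> ~ (forall c, tco v c = 0);
  cd_fiber : forall p : M, exists2 v, cd_set v & tpt v = p;
  cd_conic : forall v (l : R), cd_set v -> 0 < l -> cd_set (tscale l v)
}.

Section Fields.
Context {R : realType} {n : nat} {M : manifold R n} (A : conic_dom M).
Local Notation V := 'rV[R]_n.

Definition dom (c : chart M) : set (V * V) := natdom A c.

Definition overlap (c d : chart M) (z : V * V) : Prop :=
  dom c z /\ cdom d (cinv c z.1).

Definition ebase (i : 'I_n) : V := delta_mx 0 i.
Definition dx (i : 'I_n) : V * V := (ebase i, 0).
Definition dy (i : 'I_n) : V * V := (0, ebase i).

(* J^b_j at x, and the second derivative of the transition map w.r.t. x^j, x^k *)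
Definition jac (c d : chart M) (x : V) (b j : 'I_n) : R :=
  'd (trans c d) x (ebase j) 0 b.
Definition hess (c d : chart M) (x : V) (j k : 'I_n) : V :=
  'D_(ebase j) (fun x' => 'D_(ebase k) (trans c d) x') x.

(* All objects on A below are given by their components in the natural
   coordinates of every chart, subject to the transformation law. Components
   vanish outside the coordinate image of A, so that equal objects are Leibniz
   equal. *)

Record smooth_fun := SFun {
  sfun_val :> chart M -> V * V -> R;
  sfun_smooth : forall c, smooth_on (dom c) (sfun_val c);
  sfun_out : forall c z, ~ dom c z -> sfun_val c z = 0;
  sfun_trans : forall c d z, overlap c d z ->
    sfun_val d (ntrans c d z) = sfun_val c z
}.

(* The pair of components is (X_1^i, X_2^i), for the frame d/dx^i, d/dy^i. *)
Record vector_field := VField {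
  vfield_val :> chart M -> V * V -> V * V;
  vfield_smooth : forall c, smooth_on (dom c) (vfield_val c);
  vfield_out : forall c z, ~ dom c z -> vfield_val c z = 0;
  vfield_trans : forall c d z, overlap c d z ->
    vfield_val d (ntrans c d z) = 'd (ntrans c d) z (vfield_val c z)
}.

(* Sections of pi_A^*(TM) -> A. *)
Record tm_section := TSec {
  tsec_val :> chart M -> V * V -> V;
  tsec_smooth : forall c, smooth_on (dom c) (tsec_val c);
  tsec_out : forall c z, ~ dom c z -> tsec_val c z = 0;
  tsec_trans : forall c d z, overlap c d z ->
    tsec_val d (ntrans c d z) = 'd (trans c d) (z.1) (tsec_val c z)
}.

(* The differential of h_l is [hscale l] in natural coordinates. *)
Definition vfield_hom (a : R) (X : vector_field) : Prop :=
  forall c z l, 0 < l -> dom c z ->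
    X c (hscale l z) = l `^ a *: hscale l (X c z).

Definition tsec_hom (a : R) (Z : tm_section) : Prop :=
  forall c z l, 0 < l -> dom c z -> Z c (hscale l z) = l `^ a *: Z c z.

(* Arrays T^i_{jk} are encoded as [T j k], the vector with components T^i. *)
Definition array := 'I_n -> 'I_n -> V.

(* Sections of pi_A^*(TM (x) T^*M (x) T^*M), homogeneous of degree -1. *)
Record htensor12 := Tens {
  tens_val :> chart M -> V * V -> array;
  tens_smooth : forall c j k, smooth_on (dom c) (fun z => tens_val c z j k);
  tens_out : forall c z j k, ~ dom c z -> tens_val c z j k = 0;
  tens_trans : forall c d z j k, overlap c d z ->
    'd (trans c d) (z.1) (tens_val c z j k) =
    \sum_b \sum_l (jac c d z.1 b j * jac c d z.1 l k) *:
      tens_val d (ntrans c d z) b l;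
  tens_hom : forall c z l j k, 0 < l -> dom c z ->
    tens_val c (hscale l z) j k = l `^ (-1) *: tens_val c z j k
}.

(* The transformation law is that of the Christoffel symbols,
   Gamma'^i_{bl} J^b_j J^l_k = J^i_a Gamma^a_{jk} - d_j d_k x'^i. *)
Record anis_conn := CAnis {
  canis_val :> chart M -> V * V -> array;
  canis_smooth : forall c j k, smooth_on (dom c) (fun z => canis_val c z j k);
  canis_out : forall c z j k, ~ dom c z -> canis_val c z j k = 0;
  canis_trans : forall c d z j k, overlap c d z ->
    'd (trans c d) (z.1) (canis_val c z j k) =
    \sum_b \sum_l (jac c d z.1 b j * jac c d z.1 l k) *:
      canis_val d (ntrans c d z) b l
    + hess c d z.1 j k;
  canis_hom : forall c z l j k, 0 < l -> dom c z ->
    canis_val c (hscale l z) j k = canis_val c z j k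
}.

(* Nonlinear connections: [N c z i] is the vector with components N^a_i, and the
   map N_v sends d/dx^i to delta_{x^i} = d/dx^i - N^a_i d/dy^a. *)
Definition delta_of (N : chart M -> V * V -> 'I_n -> V) c z (i : 'I_n) : V * V :=
  (ebase i, - N c z i).

Record nonlin_conn := CNl {
  cnl_val :> chart M -> V * V -> 'I_n -> V;
  cnl_smooth : forall c i, smooth_on (dom c) (fun z => cnl_val c z i);
  cnl_out : forall c z i, ~ dom c z -> cnl_val c z i = 0;
  cnl_trans : forall c d z i, overlap c d z ->
    'd (ntrans c d) z (delta_of cnl_val c z i) =
    \sum_b jac c d z.1 b i *: delta_of cnl_val d (ntrans c d z) b;
  cnl_hom : forall c z l i, 0 < l -> dom c z ->
    delta_of cnl_val c (hscale l z) i = hscale l (delta_of cnl_val c z i)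
}.

(* The hypothesis on W in the first three axioms says that W is fX + Y, Y + Z
   and fZ respectively. *)
Record lin_conn := CLin {
  nabla :> vector_field -> tm_section -> tm_section;
  nabla_linear_l : forall (f : smooth_fun) (X Y W : vector_field) (Z : tm_section),
    (forall c z, W c z = f c z *: X c z + Y c z) ->
    forall c z, nabla W Z c z = f c z *: nabla X Z c z + nabla Y Z c z;
  nabla_add_r : forall (X : vector_field) (Y Z W : tm_section),
    (forall c z, W c z = Y c z + Z c z) ->
    forall c z, nabla X W c z = nabla X Y c z + nabla X Z c z;
  nabla_leibniz : forall (f : smooth_fun) (X : vector_field) (Z W : tm_section),
    (forall c z, W c z = f c z *: Z c z) ->
    forall c z, dom c z ->
      nabla X W c z = f c z *: nabla X Z c z + 'D_(X c z) (f c) z *: Z c z;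
  nabla_hom : forall (a b : R) (X : vector_field) (Z : tm_section),
    vfield_hom a X -> tsec_hom b Z -> tsec_hom (a + b) (nabla X Z)
}.

(* Value at the point z of dom c of [D_X Z] for X, Z defined only near z, in the
   coordinates of c: the value of [D_X' Z'] for any global X', Z' that agree with
   X, Z near z (0 if z is not in dom c). *)
Definition local_nabla (D : lin_conn) (c : chart M) (z : V * V)
    (X : V * V -> V * V) (Z : V * V -> V) : V :=
  xget 0 [set w | dom c z /\ exists (X' : vector_field) (Z' : tm_section),
    [/\ (\forall u \near z, X' c u = X u), (\forall u \near z, Z' c u = Z u)
      & w = D X' Z' c z]].

Definition gamma1 (D : lin_conn) c z : array := fun j k =>
  local_nabla D c z (fun=> dx j) (fun=> ebase k).

Definition gamma2 (D : lin_conn) c z : array := fun j k =>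
  local_nabla D c z (fun=> dy j) (fun=> ebase k).

(* The matrix (delta^i_j + T^i_{jc} y^c). *)
Definition regmx (T : array) (y : V) : 'M[R]_n :=
  \matrix_(i, j) ((i == j)%:R + \sum_k T j k 0 i * y 0 k).

Record reg_lin_conn := CReg {
  creg_val :> lin_conn;
  creg_reg : forall c z, dom c z -> regmx (gamma2 creg_val c z) z.2 \in unitmx
}.

Definition admissible (T : htensor12) : Prop :=
  forall c z, dom c z -> regmx (T c z) z.2 \in unitmx.

Record adm_htensor12 := TensAdm {
  tens_adm_val :> htensor12;
  tens_adm_P : admissible tens_adm_val
}.

Lemma tadd_smooth (S T : htensor12) c j k :
  smooth_on (dom c) (fun z => S c z j k + T c z j k).
Proof. by move=> m; apply: CkD; [exact: cd_open|exact: tens_smooth..]. Qed.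

Lemma tadd_out (S T : htensor12) c z j k : ~ dom c z -> S c z j k + T c z j k = 0.
Proof. by move=> zc; rewrite !tens_out// addr0. Qed.

Lemma tadd_trans (S T : htensor12) c d z j k : overlap c d z ->
  'd (trans c d) (z.1) (S c z j k + T c z j k) =
  \sum_b \sum_l (jac c d z.1 b j * jac c d z.1 l k) *:
    (S d (ntrans c d z) b l + T d (ntrans c d z) b l).
Proof.
move=> ov; rewrite linearD !tens_trans// -big_split; apply: eq_bigr => b _.
by rewrite -big_split; apply: eq_bigr => l _; rewrite scalerDr.
Qed.

Lemma tadd_hom (S T : htensor12) c z l j k : 0 < l -> dom c z ->
  S c (hscale l z) j k + T c (hscale l z) j k =
  l `^ (-1) *: (S c z j k + T c z j k).
Proof. by move=> l0 zc; rewrite !tens_hom// scalerDr. Qed.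

Definition tadd (S T : htensor12) : htensor12 :=
  @Tens (fun c z j k => S c z j k + T c z j k)
    (tadd_smooth S T) (tadd_out S T) (tadd_trans S T) (tadd_hom S T).

(* The maps of the theory are specified by their components in all charts; each
   specification has at most one solution. *)

Definition is_varrho (rho : anis_conn -> reg_lin_conn) : Prop :=
  forall (G : anis_conn) c z j k, dom c z ->
    gamma1 (rho G) c z j k = G c z j k /\ gamma2 (rho G) c z j k = 0.

Definition is_jmathN (jN : nonlin_conn -> lin_conn -> anis_conn) : Prop :=
  forall (N : nonlin_conn) (D : lin_conn) c z j k, dom c z ->
    jN N D c z j k =
    local_nabla D c z (fun u => delta_of N c u j) (fun=> ebase k).

Definition is_Delta (Delta : lin_conn -> htensor12) : Prop :=
  forall (D : lin_conn) c z j k, dom c z ->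
    Delta D c z j k = local_nabla D c z (fun=> dy j) (fun=> ebase k).

(* N^a_i = B^a_b (Gamma^1)^b_{ic} y^c with B the inverse of the matrix above. *)
Definition is_assoc_nl (nl : reg_lin_conn -> nonlin_conn) : Prop :=
  forall (D : reg_lin_conn) c z i a, dom c z ->
    nl D c z i 0 a =
    \sum_b invmx (regmx (gamma2 D c z) z.2) a b *
      \sum_k gamma1 D c z i k 0 b * z.2 0 k.

End Fields.

(* Main.v *)
(* In natural coordinates a homogeneous linear connection is
     D_X Z = dZ(X) + om(X, Z),   om(u, w) = Gamma1(u_1, w) + Gamma2(u_2, w),
   and everything follows from this formula together with the law relating the
   forms om of two charts under the Jacobian J of the change of coordinates,
     J om_c(u, w) = om_d(u', J w) + hess(u_1, w).
   The formula needs cutoff functions; they may depend on x alone, so the cut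
   off coordinate fields stay homogeneous and the homogeneity axiom applies to
   them.  Feeding vertical or N-horizontal vectors u into the law shows that
   Delta is a tensor and j_N(D) an anisotropic connection.  The value
   u_2 + om(u, y) of D_u on the canonical section y is tensorial, and by
   regularity its kernel is the graph of a nonlinear connection: the N of the
   map j.  Conversely (Gamma, Delta) and N give back a connection by applying
   Gamma to u_1 and Delta to the N-vertical part of u.  For N = N(D) this N
   depends on Gamma alone, as N_i = Gamma(e_i, y), which inverts
   D |-> (j D, Delta D); the invariance statements are then immediate. *)
Require Import Defs.
From HB Require Import structures.
From mathcomp Require Import all_boot all_order all_algebra.
From mathcomp Require Import all_classical all_reals all_analysis.
From mathcomp Require Import ring lra.
Import Order.TTheory GRing.Theory Num.Theory.
Import numFieldNormedType.Exports.
Set Implicit Arguments.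
Unset Strict Implicit.
Unset Printing Implicit Defensive.
Local Open Scope classical_set_scope.
Local Open Scope ring_scope.

(** * Calculus of smooth functions *)

(** The axioms of [lin_conn] speak only of global fields, whereas the coefficients and the maps of
    the theory are local. Every local fact about D is therefore read off from global fields,
    obtained by cutting off coordinate fields and extending them by zero; this is what the calculus
    and the bump functions are for. The two coefficient arrays are kept together in one form because
    [gamma1] has no law of its own: a change of coordinates sends a base coordinate field to a
    combination of base fields plus a vertical part, the Hessian contracted with y, so the law of
    [gamma1] involves [gamma2]. The form, evaluated on arbitrary vectors, has a single law, and sums
    over indices enter only when components are needed. Since components vanish outside the image of
    A, objects with equal components are equal records, and the round trips of the identifications
    reduce to comparing components in each chart. *)

Section CkTheory.
Context {R : realType} {V W : normedModType R}.
Implicit Types (U O : set V) (f g : V -> W).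

Lemma CkS k U f : Ck k.+1 U f -> Ck k U f.
Proof.
elim: k f => [|k IH] f [df Df]; last by split=> // v; exact/IH/Df.
by move=> x Ux; exact/differentiable_continuous/df.
Qed.

Lemma Ck_subset k U O f : U `<=` O -> Ck k O f -> Ck k U f.
Proof.
move=> UO; elim: k f => [|k IH] f /=; first by move=> cf x /UO; exact: cf.
by move=> [df Df]; split=> [x /UO|v]; [exact: df|exact: IH].
Qed.

(** [Ck] is a pointwise condition on derivatives of the total function f, so it passes from pieces
    to their union. *)
Lemma Ck_glue k U f :
  (forall x, U x -> exists2 O, O x & Ck k O f) -> Ck k U f.
Proof.
elim: k f => [|k IH] f /= H.
  by move=> x Ux; have [B Bx] := H _ Ux; apply.
split=> [x Ux|v]; first by have [B Bx [df _]] := H _ Ux; exact: df.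
by apply: IH => x Ux; have [B Bx [_]] := H _ Ux; exists B.
Qed.

Lemma smooth_eq U f g : open U ->
  (forall x, U x -> f x = g x) -> smooth_on U f -> smooth_on U g.
Proof. by move=> oU fg sf k; exact: Ck_eq (sf k). Qed.

Lemma smooth_subset U O f : U `<=` O -> smooth_on O f -> smooth_on U f.
Proof. by move=> UO sf k; exact: Ck_subset (sf k). Qed.

Lemma smooth_glue U f :
  (forall x, U x -> exists2 O, O x & smooth_on O f) -> smooth_on U f.
Proof.
by move=> H k; apply: Ck_glue => x /H[B Bx sf]; exists B.
Qed.

Lemma smooth_diff U f x : smooth_on U f -> U x -> differentiable f x.
Proof. by move=> /(_ 1%N)[df _] /df. Qed.

Lemma smooth_derive U f v : smooth_on U f -> smooth_on U ('D_v f).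
Proof. by move=> sf k; have [_] := sf k.+1; apply. Qed.

Lemma smooth_cst U (a : W) : smooth_on U (fun=> a).
Proof.
move=> k; elim: k a => [|k IH] a /=; first by move=> x _; exact: cst_continuous.
split=> [x _|v]; first exact: differentiable_cst.
suff -> : (fun x => 'D_v (fun=> a) x) = fun=> 0 by exact: IH.
by apply/funext => x; rewrite derive_cst.
Qed.

Lemma smoothD U f g : open U -> smooth_on U f -> smooth_on U g ->
  smooth_on U (fun x => f x + g x).
Proof. by move=> oU sf sg k; exact: CkD. Qed.

Lemma smooth_sum U (I : Type) (r : seq I) (P : pred I) (F : I -> V -> W) :
  open U -> (forall i, P i -> smooth_on U (F i)) ->
  smooth_on U (fun x => \sum_(i <- r | P i) F i x).
Proof.
move=> oU sF; elim: r => [|i r IH].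
  by apply: smooth_eq (smooth_cst U 0) => // x _; rewrite big_nil.
case Pi : (P i).
  by apply: smooth_eq (smoothD oU (sF i Pi) IH) => // x _; rewrite big_cons Pi.
by apply: smooth_eq IH => // x _; rewrite big_cons Pi.
Qed.

End CkTheory.

Lemma smooth_linear (R : realType) (V W W' : normedModType R) (U : set V)
    (f : V -> W) (L : {linear W -> W'}) : open U -> continuous L ->
  smooth_on U f -> smooth_on U (fun x => L (f x)).
Proof.
move=> oU cL sf k; move: (sf k) => {sf}; elim: k f => [|k IH] f /=.
  by move=> cf x Ux; apply: continuous_comp; [exact: cf|exact: cL].
move=> [df Df]; split=> [x Ux|v].
  by apply: differentiable_comp; [exact: df|exact: linear_differentiable].
apply: Ck_eq (IH _ (Df v)) => // x Ux.
have dL : differentiable L (f x) by exact: linear_differentiable.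
rewrite !deriveE; [|exact: (differentiable_comp (df _ Ux) dL)|exact: df].
by rewrite (diff_comp (df _ Ux) dL) /= diff_lin.
Qed.

Section scale.
Context {R : realType} {V W : normedModType R}.

(** A name for scaling to which a bilinear structure can be attached; the product rule is then the
    differential of a bilinear map. *)
Let scl (a : R) (w : W) : W := a *: w.

Let scl_bilinear : bilinear_for
  (GRing.Scale.Law.clone _ _ *:%R _) (GRing.Scale.Law.clone _ _ *:%R _) scl.
Proof.
split => [u a b c|u a b c] /=; rewrite /scl.
- by rewrite scalerDl scalerA.
- by rewrite scalerDr !scalerA mulrC.
Qed.

HB.instance Definition _ := bilinear_isBilinear.Build R R W W
  (GRing.Scale.Law.clone _ _ *:%R _) (GRing.Scale.Law.clone _ _ *:%R _) scl
  scl_bilinear.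

Lemma differentiable_scale (f : V -> R) (g : V -> W) x :
  differentiable f x -> differentiable g x ->
  differentiable (fun y => f y *: g y) x /\
  forall v, 'd (fun y => f y *: g y) x v = f x *: 'd g x v + 'd f x v *: g x.
Proof.
move=> df dg.
have cS : continuous (fun p : R * W => scl p.1 p.2).
  by move=> p; exact: scale_continuous.
have dS p : differentiable (fun p : R * W => scl p.1 p.2) p.
  exact: differentiable_bilin.
have dp : differentiable (fun y => (f y, g y)) x by exact: differentiable_pair.
split; first exact: (differentiable_comp dp (dS _)).
move=> v; rewrite (diff_comp dp (dS _)) /= diff_bilin//= diff_pair//=.
Qed.

(** The Leibniz rule leaves products of one factor with a derivative of the other; the
    undifferentiated factor drops to order k by [CkS]. *)
Lemma CkZ k (U : set V) (f : V -> R) (g : V -> W) : open U ->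
  Ck k U f -> Ck k U g -> Ck k U (fun x => f x *: g x).
Proof.
move=> oU; elim: k f g => [|k IH] f g.
  by move=> cf cg x Ux; apply: cvgZ; [exact: cf|exact: cg].
move=> Cf Cg; move: (Cf) (Cg) => [df Df] [dg Dg]; split=> [x Ux|v].
  by have [] := differentiable_scale (df _ Ux) (dg _ Ux).
have C1 := IH _ _ (CkS Cf) (Dg v).
have C2 := IH _ _ (Df v) (CkS Cg).
apply: Ck_eq (CkD oU C2 C1) => // x Ux.
have [d1 d2] := differentiable_scale (df _ Ux) (dg _ Ux).
by rewrite (deriveE _ d1) d2 (deriveE _ (df _ Ux)) (deriveE _ (dg _ Ux)) addrC.
Qed.

Lemma smoothZ (U : set V) (f : V -> R) (g : V -> W) : open U ->
  smooth_on U f -> smooth_on U g -> smooth_on U (fun x => f x *: g x).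
Proof. by move=> oU sf sg k; exact: CkZ. Qed.

End scale.

(* A basis with continuous coordinates, which is the only trace of finite
   dimension needed to differentiate compositions. *)
Record frame (R : realType) (V : normedModType R) := Frame {
  fidx : finType;
  fvec : fidx -> V;
  fco : fidx -> {linear V -> R};
  fco_continuous : forall i, continuous (fco i);
  fco_sum : forall v, v = \sum_i fco i v *: fvec i
}.
Arguments fvec {R V}.
Arguments fco {R V}.

Section composition.
Context {R : realType}.
Implicit Types V W : normedModType R.

Lemma diff_frame V W (F : frame V) (f : V -> W) x v : differentiable f x ->
  'd f x v = \sum_i fco F i v *: 'D_(fvec F i) f x.
Proof.
move=> df; rewrite {1}(fco_sum F v) linear_sum; apply: eq_bigr => i _.
by rewrite linearZ (deriveE _ df).
Qed.

(** In a frame the differential is a combination of directional derivatives, which are smooth by the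
    very definition of [smooth_on]. *)
Lemma smooth_differential V W (F : frame V) (U : set V) (f : V -> W)
    (v : V -> V) : open U -> smooth_on U f -> smooth_on U v ->
  smooth_on U (fun x => 'd f x (v x)).
Proof.
move=> oU sf sv.
apply: (@smooth_eq _ _ _ _
  (fun x => \sum_i fco F i (v x) *: 'D_(fvec F i) f x)) => // [x Ux|].
  by rewrite (diff_frame F)//; exact: smooth_diff sf Ux.
apply: smooth_sum => // i _; apply: smoothZ => //; last exact: smooth_derive.
by apply: smooth_linear => //; exact: fco_continuous.
Qed.

(** Induction on the order of g alone: by the chain rule in a frame, a derivative of the composite
    is a sum of smooth coefficients times frame derivatives of g, of one order less, composed with
    f. *)
Lemma smooth_comp V V' W (F : frame V') (U : set V) (U' : set V') (f : V -> V')
    (g : V' -> W) : open U -> (forall x, U x -> U' (f x)) ->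
  smooth_on U f -> smooth_on U' g -> smooth_on U (fun x => g (f x)).
Proof.
move=> oU fU sf sg k; move: (sg k) => {sg}; elim: k g => [|k IH] g.
  move=> cg x Ux; apply: continuous_comp; last exact/cg/fU.
  exact: (sf 0%N).
move=> [dg Dg]; split=> [x Ux|v].
  by apply: differentiable_comp; [exact: smooth_diff sf Ux|exact/dg/fU].
pose T i x := fco F i ('D_v f x) *: 'D_(fvec F i) g (f x).
apply: (@Ck_eq _ _ _ _ _ (fun x => \sum_i T i x)) => // [x Ux|].
  have df := smooth_diff sf Ux; have dgx := dg _ (fU _ Ux).
  rewrite (deriveE _ (differentiable_comp df dgx)) (diff_comp df dgx) /=.
  by rewrite (diff_frame F _ dgx) -(deriveE _ df).
have CT i : Ck k U (T i).
  have /(_ k) C1 : smooth_on U (fun x => fco F i ('D_v f x)).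
    by apply: smooth_linear; [|exact: fco_continuous|exact: smooth_derive].
  have C2 := IH _ (Dg (fvec F i)).
  by apply: CkZ.
elim: (index_enum _) => [|i r IHr].
  by apply: Ck_eq (smooth_cst U (0 : W) k) => // x _; rewrite big_nil.
by apply: Ck_eq (CkD oU (CT i) IHr) => // x _; rewrite big_cons.
Qed.

End composition.

Section frames.
Context {R : realType}.

Definition frame_R : frame R.
Proof.
refine (@Frame R R unit (fun=> 1) (fun=> idfun) _ _) => [_ v|v].
  exact: cvg_id.
by rewrite (big_pred1 tt) => [|[]//]; rewrite /GRing.scale /= mulr1.
Defined.

Definition rcoord (n : nat) (i : 'I_n) (v : 'rV[R]_n) : R := v 0 i.

Fact rcoord_linear n (i : 'I_n) : linear (rcoord i).
Proof. by move=> a u v; rewrite /rcoord !mxE. Qed.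
HB.instance Definition _ n (i : 'I_n) :=
  GRing.isLinear.Build R 'rV[R]_n R _ (rcoord i) (rcoord_linear i).

Lemma rcoord_continuous n (i : 'I_n) : continuous (rcoord i).
Proof. exact: coord_continuous. Qed.

Definition frame_rV (n : nat) : frame 'rV[R]_n.
Proof.
refine (@Frame R _ 'I_n (fun i => delta_mx 0 i) (fun i => rcoord i) _ _).
  exact: rcoord_continuous.
exact: row_sum_delta.
Defined.

Variables V W : normedModType R.

Definition inl_lin (v : V) : V * W := (v, 0).
Definition inr_lin (w : W) : V * W := (0, w).
Fact inl_linear : linear inl_lin.
Proof. by move=> a u v; congr pair; rewrite /= scaler0 addr0. Qed.
Fact inr_linear : linear inr_lin.
Proof. by move=> a u v; congr pair; rewrite /= scaler0 addr0. Qed.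
HB.instance Definition _ :=
  GRing.isLinear.Build R V (V * W)%type _ inl_lin inl_linear.
HB.instance Definition _ :=
  GRing.isLinear.Build R W (V * W)%type _ inr_lin inr_linear.

Lemma inl_continuous : continuous inl_lin.
Proof. by move=> v; apply: cvg_pair; [exact: cvg_id|exact: cvg_cst]. Qed.
Lemma inr_continuous : continuous inr_lin.
Proof. by move=> v; apply: cvg_pair; [exact: cvg_cst|exact: cvg_id]. Qed.

Lemma fst_continuous : continuous (fst : V * W -> V).
Proof. by move=> v; exact: cvg_fst. Qed.
Lemma snd_continuous : continuous (snd : V * W -> W).
Proof. by move=> v; exact: cvg_snd. Qed.

(** Left transparent: its indices [inl j] and [inr j] are later matched with the coordinate fields
    in the x and y directions. *)
Definition frame_prod (F : frame V) (G : frame W) : frame (V * W)%type.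
Proof.
refine (@Frame R _ (fidx F + fidx G)%type
  (fun i => match i with inl i => inl_lin (fvec F i) | inr i =>
    inr_lin (fvec G i) end)
  (fun i => match i with inl i => fco F i \o fst | inr i =>
    fco G i \o snd end) _ _).
  case=> i v /=; apply: continuous_comp.
  - exact: fst_continuous.
  - exact: fco_continuous.
  - exact: snd_continuous.
  - exact: fco_continuous.
move=> [v w]; rewrite big_sumType /=.
under eq_bigr do rewrite -linearZ.
rewrite -linear_sum -fco_sum.
under eq_bigr do rewrite -linearZ.
by rewrite -linear_sum -fco_sum; congr pair; rewrite /= ?addr0 ?add0r.
Defined.

End frames.

Section smooth_operations.
Context {R : realType} {V : normedModType R}.
Variables (U : set V) (oU : open U).

Lemma smooth_id : smooth_on U (@id V).
Proof.
case=> [|k] /=; first by move=> x _; exact: cvg_id.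
split=> [x _|v]; first exact: ex_diff.
apply: Ck_eq (smooth_cst U v k) => // x _; exact/esym/derive_id.
Qed.

Lemma smooth_coord n (f : V -> 'rV[R]_n) i :
  smooth_on U f -> smooth_on U (fun z => f z 0 i).
Proof. by move=> sf; apply:
  (smooth_linear oU (@rcoord_continuous R n i) sf). Qed.

Lemma smooth_row n (f : V -> 'rV[R]_n) :
  (forall i, smooth_on U (fun z => f z 0 i)) -> smooth_on U f.
Proof.
move=> sf; apply: (@smooth_eq _ _ _ _ (fun z => \sum_i f z 0 i *:
  delta_mx 0 i)).
- by [].
- by move=> z _; rewrite -row_sum_delta.
by apply: smooth_sum => // i _; apply: smoothZ => //; exact: smooth_cst.
Qed.

Lemma smooth_pair (W W' : normedModType R) (f : V -> W) (g : V -> W') :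
  smooth_on U f -> smooth_on U g -> smooth_on U (fun z => (f z, g z)).
Proof.
move=> sf sg; have s1 := smooth_linear oU (@inl_continuous R W W') sf.
have s2 := smooth_linear oU (@inr_continuous R W W') sg.
apply: smooth_eq (smoothD oU s1 s2) => // z _.
by congr pair; rewrite /= ?addr0 ?add0r.
Qed.

Lemma smooth_fst (W W' : normedModType R) (f : V -> W * W') :
  smooth_on U f -> smooth_on U (fun z => (f z).1).
Proof. exact: (smooth_linear oU (@fst_continuous R W W')). Qed.

Lemma smooth_snd (W W' : normedModType R) (f : V -> W * W') :
  smooth_on U f -> smooth_on U (fun z => (f z).2).
Proof. exact: (smooth_linear oU (@snd_continuous R W W')). Qed.

Lemma smoothN (W : normedModType R) (f : V -> W) :
  smooth_on U f -> smooth_on U (fun z => - f z).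
Proof.
move=> sf; apply: smooth_eq (@smoothZ R V W U (fun=> -1) f oU (smooth_cst U _)
  sf) => // z _.
by rewrite scaleN1r.
Qed.

Lemma smoothM (f g : V -> R) :
  smooth_on U f -> smooth_on U g -> smooth_on U (fun z => f z * g z).
Proof. exact: (@smoothZ R V R U f g oU). Qed.

Lemma smooth_prod (I : Type) (r : seq I) (P : pred I) (F : I -> V -> R) :
  (forall i, P i -> smooth_on U (F i)) ->
  smooth_on U (fun x => \prod_(i <- r | P i) F i x).
Proof.
move=> sF; elim: r => [|i r IH].
  by apply: smooth_eq (smooth_cst U (1 : R)) => // x _; rewrite big_nil.
case Pi : (P i).
  by apply: smooth_eq (smoothM (sF i Pi) IH) => // x _; rewrite big_cons Pi.
by apply: smooth_eq IH => // x _; rewrite big_cons Pi.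
Qed.

Lemma smooth_det n (A : V -> 'M[R]_n) :
  (forall i j, smooth_on U (fun z => A z i j)) ->
  smooth_on U (fun z => \det (A z)).
Proof.
move=> sA; apply: smooth_sum => // s _; apply: smoothM; first exact: smooth_cst.
by apply: smooth_prod => i _; exact: sA.
Qed.

End smooth_operations.

(** * Inversion of scalars and matrices *)

Section inverse.
Context {R : realType}.

Lemma open_neq0 : open [set x : R | x != 0].
Proof.
rewrite (_ : [set _ | _] = ~` [set 0]); last by apply/seteqP; split=> x /eqP.
exact/closed_openC/closed_eq.
Qed.

(** The derivative of the inverse is a product of copies of the inverse, so the induction closes on
    itself. *)
Lemma smooth_Rinv : smooth_on [set x : R | x != 0] (@GRing.inv R).
Proof.
move=> k; elim: k => [|k IH]; first by move=> x /= x0; exact: inv_continuous.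
split=> [x /= x0|v]; first exact: differentiable_Rinv.
apply: (@Ck_eq _ _ _ _ _ (fun x : R => (- v) *: (x^-1 *: x^-1))) open_neq0 _ _.
  move=> x /= x0; rewrite (deriveE _ (differentiable_Rinv x0)) diff_Rinv//.
  by rewrite /GRing.scale /=; field.
by apply: CkZ; [exact: open_neq0|exact: smooth_cst|exact/CkZ/IH/IH/open_neq0].
Qed.

Lemma smooth_inv (V : normedModType R) (U : set V) (f : V -> R) : open U ->
  (forall z, U z -> f z != 0) -> smooth_on U f ->
    smooth_on U (fun z => (f z)^-1).
Proof.
move=> oU f0 sf.
by apply: (smooth_comp frame_R (U' := [set x : R | x != 0])) => //;
  exact: smooth_Rinv.
Qed.

(** Cramer's formula: the entries are cofactors divided by the determinant. *)
Lemma smooth_invmx (V : normedModType R) (U : set V) n (A : V -> 'M[R]_n) i j :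
  open U -> (forall z, U z -> A z \in unitmx) ->
  (forall i j, smooth_on U (fun z => A z i j)) ->
  smooth_on U (fun z => invmx (A z) i j).
Proof.
move=> oU uA sA.
apply: (@smooth_eq _ _ _ _ (fun z => (\det (A z))^-1 * \adj (A z) i j)) => //.
  by move=> z Uz; rewrite /invmx uA// !mxE.
apply: smoothM => //.
  apply: smooth_inv => //; last exact: smooth_det.
  by move=> z /uA; rewrite unitmxE unitfE.
apply: (@smooth_eq _ _ _ _ (fun z => cofactor (A z) j i)) => //.
  by move=> z _; rewrite mxE.
apply: smoothM => //; first exact: smooth_cst.
apply: smooth_det => // a b.
by apply: smooth_eq (sA (lift j a) (lift i b)) => // z _; rewrite !mxE.
Qed.

End inverse.

(** * Bump functions *)

Section flat.
Context {R : realType}.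
Implicit Types (p : {poly R}) (x : R).

(** The classical exp(-1/x) with a polynomial factor in 1/x: this enlarged family is stable under
    differentiation, so all orders are treated at once. *)
Definition flat p x : R := if 0 < x then p.[x^-1] * expR (- x^-1) else 0.

(** Each monomial satisfies t^i <= i! exp(t), whence the constant. *)
Lemma horner_le_expR p :
  exists2 C : R, 0 <= C & forall t, 0 <= t -> `|p.[t]| <= C * expR t.
Proof.
exists (\sum_(i < size p) `|p`_i| * i`!%:R) => [|t t0].
  by apply: sumr_ge0 => i _; rewrite mulr_ge0.
rewrite horner_coef mulr_suml (le_trans (ler_norm_sum _ _ _))//.
apply: ler_sum => i _; rewrite normrM -mulrA ler_wpM2l// normrX (ger0_norm t0).
case: (nat_of_ord i) => [|m].
  by rewrite fact0 mul1r expr0 (le_trans _ (expR_ge1Dx t))// lerDl.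
rewrite mulrC -ler_pdivrMr ?ltr0n ?fact_gt0//.
by rewrite (le_trans _ (expR_ge1Dxn m t0))// lerDr.
Qed.

(** The exponential bound for X^2 p at t = 1/x. The quadratic decay is what gives derivative 0 at
    the origin. *)
Lemma flat_le p : exists2 C : R, 0 <= C & forall x, `|flat p x| <= C * x ^+ 2.
Proof.
have [C C0 HC] := horner_le_expR ('X^2 * p); exists C => // x; rewrite /flat.
case: ifPn => [x0|_]; last by rewrite normr0 mulr_ge0// sqr_ge0.
have := HC x^-1; rewrite invr_ge0 ltW// => /(_ isT).
rewrite hornerM hornerXn normrM (ger0_norm (exprn_ge0 _ _)) ?invr_ge0 ?(ltW
  x0)//.
rewrite exprVn normrM (@ger0_norm _ (expR _)) ?expR_ge0//.
rewrite -ler_pdivlMl ?invr_gt0 ?exprn_gt0// invrK => h.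
rewrite expRN -(ler_pM2r (expR_gt0 x^-1)) mulfVK ?gt_eqF ?expR_gt0//.
by rewrite (le_trans h)// mulrA [_ * C]mulrC.
Qed.

(** For x > 0 the exponential contributes x^-2 p(1/x) and the polynomial -x^-2 p'(1/x), which is X^2
    (p - p') evaluated at 1/x. *)
Lemma is_derive_flat p x :
  is_derive x 1 (flat p) (flat ('X^2 * (p - p^`())) x).
Proof.
have [x0|x0|->] := ltgtP x 0.
- have fE : \near x, cst 0 x = flat p x.
    by near=> y; rewrite /flat ifF//; apply/negbTE; rewrite -leNgt ltW//;
      near: y; exact: lt_nbhsl.
  rewrite {2}/flat ifF; last by apply/negbTE; rewrite -leNgt ltW.
  by apply: near_eq_is_derive fE _ => //.
- have fE : \near x, (p.[x^-1] * expR (- x^-1)) = flat p x.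
    by near=> y; rewrite /flat ifT//; near: y; exact: lt_nbhsr.
  rewrite {2}/flat ifT//.
  apply: near_eq_is_derive fE _ => //.
  have xn0 : x != 0 by rewrite gt_eqF.
  have dV : is_derive x 1 (@GRing.inv R) (- x ^- 2 *: (1 : R)).
    exact: (is_deriveV (f := id)).
  have dp : is_derive x 1 (horner p \o @GRing.inv R)
     ((p^`()).[x^-1] * (- x ^- 2 *: (1 : R))) by exact: is_derive1_comp.
  have de : is_derive x 1 (expR \o (fun y : R => - y^-1))
     (expR (- x^-1) * - (- x ^- 2 *: (1 : R))) by exact: is_derive1_comp.
  apply: (is_derive_eq (is_deriveM dp de)).
  rewrite hornerM hornerXn hornerD hornerN /GRing.scale /=; field.
  done.
have [C C0 HC] := flat_le p.
have f0 q : flat q 0 = 0 by rewrite /flat ltxx.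
rewrite f0.
(* By the quadratic bound the difference quotient at 0 is at most C |h|. *)
suff H : h^-1 *: (flat p (h *: (1 : R) + 0) - flat p 0) @[h --> 0^'] --> (0 :
  R).
  by apply: DeriveDef; [exact: cvgP H|exact: cvg_lim H].
apply/cvgr0Pnorm_le => e e0.
near=> h.
have h0 : h != 0 by near: h; exact: nbhs_dnbhs_neq.
rewrite f0 subr0 addr0 normrM normfV.
rewrite ler_pdivrMl ?normr_gt0// /GRing.scale /= mulr1 (le_trans (HC _))//.
rewrite -(real_normK (num_real h)) expr2 mulrCA ler_wpM2l//.
(* C may be 0, so C + 1 serves as a positive divisor when h is chosen small. *)
rewrite (le_trans (_ : _ <= (C + 1) * `|h|))//;
  first by rewrite ler_wpM2r ?lerDl.
rewrite mulrC -ler_pdivlMr ?ltr_wpDl//.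
near: h; apply: dnbhs0_le; rewrite divr_gt0// ltr_wpDl//.
Unshelve. all: end_near. Qed.

Lemma smooth_flat p : smooth_on setT (flat p).
Proof.
move=> k; elim: k p => [|k IH] p.
  move=> x _; apply: differentiable_continuous; apply/derivable1_diffP.
  by have [] := is_derive_flat p x.
have df x : differentiable (flat p) x.
  by apply/derivable1_diffP; have [] := is_derive_flat p x.
split=> [x _|v]; first exact: df.
apply: (@Ck_eq _ _ _ _ _ (fun x => v *: flat ('X^2 * (p - p^`())) x)) openT _ _.
  move=> x _; rewrite (deriveE _ (df x)) -[in RHS](mulr1 v) linearZ /=.
  by rewrite -(deriveE _ (df x)); have [_ ->] := is_derive_flat p x.
by apply: CkZ (IH _); [exact: openT|exact: smooth_cst].
Qed.

(* Composing the flat function with itself gives a plateau without a quotient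
   of smooth functions. *)
Definition step x : R := flat 1 (expR (-1) - flat 1 x) / flat 1 (expR (-1)).

Lemma smooth_step : smooth_on setT step.
Proof.
apply: smoothM; [exact: openT| |exact: smooth_cst].
apply: (smooth_comp frame_R (U' := setT)) (smooth_flat _) => //.
  exact: openT.
apply: smoothD; [exact: openT|exact: smooth_cst|].
by apply: smoothN; [exact: openT|exact: smooth_flat].
Qed.

Lemma flat1E x : 0 < x -> flat 1 x = expR (- x^-1).
Proof. by move=> x0; rewrite /flat x0 hornerE mul1r. Qed.

Lemma step1 x : x <= 0 -> step x = 1.
Proof.
move=> x0; rewrite /step {2}/flat ltNge x0 /= subr0 divff//.
by rewrite flat1E ?expR_gt0// gt_eqF// expR_gt0.
Qed.

(** For x >= 1 the inner value is at least exp(-1), so the outer argument is nonpositive, where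
    [flat] vanishes. *)
Lemma step0 x : 1 <= x -> step x = 0.
Proof.
move=> x1; have x0 : 0 < x by exact: lt_le_trans x1.
rewrite /step {1}/flat ifF ?mul0r// flat1E//; apply/negbTE.
by rewrite -leNgt subr_le0 ler_expR lerN2 invf_le1.
Qed.

End flat.

(** * Bumps with compact support in coordinate space *)

Section bump.
Context {R : realType} {n : nat}.
Local Notation V := 'rV[R]_n.

(** K is a cube, compact as a product of segments and contained in a ball of the sup norm. The bump
    is a function of the sum of squares, which is smooth where the sup norm is not. *)
Lemma bump_exists (U : set V) x0 : open U -> U x0 ->
  exists (K : set V) (b : V -> R),
  [/\ compact K, K `<=` U, smooth_on setT b,
      \forall x \near x0, b x = 1 & forall x, ~ K x -> b x = 0].
Proof.
move=> oU Ux0.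
have /nbhs_ballP[e /= e0 eU] : nbhs x0 U by exact: open_nbhs_nbhs.
pose K := [set v : V | forall i, `[x0 0 i - e / 2,
  x0 0 i + e / 2]%classic (v 0 i)].
pose q (x : V) := \sum_i (x 0 i - x0 0 i) ^+ 2.
(* The argument is at most 0 when q <= e^2/8, which holds near x0, and at least 1 when q >= e^2/4,
   which holds off the cube because some coordinate is then off by more than e/2. *)
pose b (x : V) := step (q x * (8 / e ^+ 2) - 1).
have sq : smooth_on setT q.
  apply: smooth_sum; [exact: openT|move=> i _].
  have s1 : smooth_on setT (fun x : V => x 0 i - x0 0 i).
    apply: smoothD; [exact: openT| |exact: smooth_cst].
    by apply: smooth_coord; [exact: openT|apply: smooth_id; exact: openT].
  exact: (smoothM openT s1 s1).
exists K, b; split.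
- by apply: (@rV_compact R n (fun i =>
  `[x0 0 i - e / 2, x0 0 i + e / 2]%classic)) => i; exact: segment_compact.
- move=> v Kv; apply: eU; split => // i j; rewrite ord1.
  have /= := Kv j; rewrite in_itv /= /ball /= => /andP[h1 h2].
  rewrite ltr_norml; apply/andP; split; lra.
- apply: (smooth_comp frame_R (U' := setT)) smooth_step => //;
  first exact: openT.
  apply: smoothD; [exact: openT| |exact: smooth_cst].
  by apply: smoothM; [exact: openT| |exact: smooth_cst].
- have /cvgrPdist_lt cq : {for x0, continuous q} by exact: (sq 0%N).
  have d0 : 0 < e ^+ 2 / 8 by rewrite divr_gt0// exprn_gt0.
  near=> x.
  rewrite /b step1// subr_le0 -[8 / _]invf_div ler_pdivrMr// mul1r ltW//.
  have : `|q x0 - q x| < e ^+ 2 / 8 by near: x; exact: cq.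
  rewrite {1}/q big1 ?sub0r ?normrN => [|i _]; last by rewrite subrr expr0n.
  by apply: le_lt_trans; exact: ler_norm.
- move=> x /existsNP[i xi]; rewrite /b step0//.
  rewrite lerBrDr -[8 / _]invf_div ler_pdivlMr ?divr_gt0 ?exprn_gt0//.
  rewrite /q (bigD1 i)//= ler_wpDr ?sumr_ge0// => [j _|]; first exact: sqr_ge0.
  have : e / 2 < `|x 0 i - x0 0 i|.
    rewrite ltNge; apply/negP => h; apply: xi; rewrite /= in_itv /=.
    by move: h; rewrite ler_norml => /andP[h1 h2]; apply/andP; split; lra.
  move=> h; rewrite -[leRHS]real_normK ?num_real//.
  have : (e / 2) ^+ 2 <= `|x 0 i - x0 0 i| ^+ 2.
    by rewrite ler_sqr ?nnegrE ?normr_ge0 ?divr_ge0 ?(ltW e0) ?(ltW h).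
  apply: le_trans; rewrite !expr2; lra.
Unshelve. all: end_near. Qed.

End bump.

(** * Changes of coordinates *)

Section bil.
Context {R : realType} {n : nat}.
Local Notation V := 'rV[R]_n.
Implicit Types (T : 'I_n -> 'I_n -> V) (u w : V).

Definition bil T u w : V := \sum_j \sum_k (u 0 j * w 0 k) *: T j k.

Lemma bilPl T a u u' w : bil T (a *: u + u') w = a *: bil T u w + bil T u' w.
Proof.
rewrite /bil scaler_sumr -big_split; apply: eq_bigr => j _.
rewrite scaler_sumr -big_split; apply: eq_bigr => k _.
by rewrite /= !mxE scalerA mulrDl scalerDl mulrA.
Qed.

Lemma bilPr T a u w w' : bil T u (a *: w + w') = a *: bil T u w + bil T u w'.
Proof.
rewrite /bil scaler_sumr -big_split; apply: eq_bigr => j _.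
rewrite scaler_sumr -big_split; apply: eq_bigr => k _.
by rewrite /= !mxE scalerA mulrDr scalerDl mulrCA.
Qed.

Lemma bil0l T w : bil T 0 w = 0.
Proof. by have := bilPl T (-1) 0 0 w;
  rewrite scaleN1r oppr0 addr0 scaleN1r addNr. Qed.
Lemma bil0r T u : bil T u 0 = 0.
Proof. by have := bilPr T (-1) u 0 0;
  rewrite scaleN1r oppr0 addr0 scaleN1r addNr. Qed.
Lemma bilDl T u u' w : bil T (u + u') w = bil T u w + bil T u' w.
Proof. by rewrite -[u in LHS]scale1r bilPl scale1r. Qed.
Lemma bilDr T u w w' : bil T u (w + w') = bil T u w + bil T u w'.
Proof. by rewrite -[w in LHS]scale1r bilPr scale1r. Qed.
Lemma bilZl T a u w : bil T (a *: u) w = a *: bil T u w.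
Proof. by rewrite -[a *: u]addr0 bilPl bil0l addr0. Qed.
Lemma bilZr T a u w : bil T u (a *: w) = a *: bil T u w.
Proof. by rewrite -[a *: w]addr0 bilPr bil0r addr0. Qed.
Lemma bilNl T u w : bil T (- u) w = - bil T u w.
Proof. by rewrite -scaleN1r bilZl scaleN1r. Qed.

Lemma bil_scale T a u w : bil (fun j k => a *: T j k) u w = a *: bil T u w.
Proof.
rewrite /bil scaler_sumr; apply: eq_bigr => j _; rewrite scaler_sumr.
by apply: eq_bigr => k _; rewrite !scalerA mulrC.
Qed.

Lemma bil_sumr T u (I : Type) (r : seq I) (F : I -> V) :
  bil T u (\sum_(i <- r) F i) = \sum_(i <- r) bil T u (F i).
Proof. by apply: (big_morph (bil T u)) => [v w|]; rewrite ?bilDr ?bil0r. Qed.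

Lemma bil_base T j k : bil T (delta_mx 0 j) (delta_mx 0 k) = T j k.
Proof.
rewrite /bil (bigD1 j)//= (bigD1 k)//= !mxE !eqxx mulr1 scale1r.
rewrite !big1 ?addr0// => [i ij|i ik];
  last by rewrite !mxE (negbTE ik) mulr0 scale0r.
by rewrite big1// => l _; rewrite !mxE (negbTE ij) mul0r scale0r.
Qed.

Lemma bil_linear T (L : {linear V -> V}) u w :
  L (bil T u w) = bil (fun j k => L (T j k)) u w.
Proof.
rewrite /bil linear_sum; apply: eq_bigr => j _; rewrite linear_sum.
by apply: eq_bigr => k _; rewrite linearZ.
Qed.

Lemma bil0T u w : bil (fun _ _ => 0 : V) u w = 0.
Proof. by rewrite /bil big1// => j _; rewrite big1// => k _;
  rewrite scaler0. Qed.

Lemma bil_basel T i w :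
  bil T (delta_mx 0 i) w = \sum_k w 0 k *: T i k.
Proof.
rewrite /bil (bigD1 i)//= [X in _ + X]big1 ?addr0 => [|j ji].
  by apply: eq_bigr => k _; rewrite !mxE !eqxx mul1r.
by rewrite big1// => k _; rewrite !mxE (negbTE ji) mul0r scale0r.
Qed.

(** Reduces transformation laws to coordinate vectors; bilinearity is asked pointwise so that f may
    be any expression built from differentials. *)
Lemma bil_ext T (f : V -> V -> V) :
  (forall a u u' w, f (a *: u + u') w = a *: f u w + f u' w) ->
  (forall a u w w', f u (a *: w + w') = a *: f u w + f u w') ->
  (forall j k, f (delta_mx 0 j) (delta_mx 0 k) = T j k) ->
  forall u w, f u w = bil T u w.
Proof.
move=> fl fr fT u w.
have f0l w' : f 0 w' = 0.
  by have := fl (-1) 0 0 w'; rewrite scaleN1r oppr0 addr0 scaleN1r addNr.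
have f0r u' : f u' 0 = 0.
  by have := fr (-1) u' 0 0; rewrite scaleN1r oppr0 addr0 scaleN1r addNr.
rewrite {1}(row_sum_delta u) (big_morph (f ^~ w) (id1 := 0) (op1 := +%R));
  last 2 first.
- by move=> a b; rewrite -[a in LHS]scale1r fl scale1r.
- exact: f0l.
apply: eq_bigr => j _; rewrite -[_ *: _]addr0 fl f0l addr0.
rewrite {1}(row_sum_delta w) (big_morph (f (delta_mx 0 j)) (id1 :=
  0) (op1 := +%R)); last 2 first.
- by move=> a b; rewrite -[a in LHS]scale1r fr scale1r.
- exact: f0r.
rewrite scaler_sumr; apply: eq_bigr => k _.
by rewrite -[X in f _ X]addr0 fr f0r addr0 fT scalerA.
Qed.

Lemma smooth_bil (W : normedModType R) (U : set W) (T : W -> 'I_n -> 'I_n -> V)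
    (u w : W -> V) : open U -> (forall j k, smooth_on U (fun z => T z j k)) ->
  smooth_on U u -> smooth_on U w ->
    smooth_on U (fun z => bil (T z) (u z) (w z)).
Proof.
move=> oU sT su sw; apply: smooth_sum => // j _; apply: smooth_sum => // k _.
by apply: smoothZ => //; apply: smoothM => //; exact: smooth_coord.
Qed.

End bil.

Section derivative_rules.
Context {R : realType} {n : nat}.
Local Notation V := 'rV[R]_n.

Lemma derive_linear (V' W W' : normedModType R) (L : {linear W -> W'})
    (f : V' -> W) x v : continuous L -> differentiable f x ->
  differentiable (fun y => L (f y)) x /\
  'D_v (fun y => L (f y)) x = L ('D_v f x).
Proof.
move=> cL df; have dL : differentiable L (f x) by exact: linear_differentiable.
have dLf := differentiable_comp df dL; split=> //.
by rewrite (deriveE _ dLf) (diff_comp df dL) (deriveE _ df) /= diff_lin.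
Qed.

Lemma derive_fst (W : normedModType R) (g : V -> W) (z u : V * V) :
  differentiable g (z.1) ->
  differentiable (fun y : V * V => g y.1) z /\
  'D_u (fun y : V * V => g y.1) z = 'd g (z.1) (u.1).
Proof.
move=> dg; have dF : differentiable (fst : V * V -> V) z.
  by apply: linear_differentiable; exact: fst_continuous.
have dgF := differentiable_comp dF dg; split=> //.
rewrite (deriveE _ dgF) (diff_comp dF dg) /= diff_lin//.
exact: fst_continuous.
Qed.

End derivative_rules.

(** The chain rule for identities valid only near a point, as those between transition maps are. The
    image point is a separate variable y, so that it can be given in whichever form the differential
    of g needs. *)
Lemma diff_comp_near (R : realType) (V W W' : normedModType R) (f : V -> W)
    (g : W -> W') (h : V -> W') x y v : f x = y ->
  differentiable f x -> differentiable g y -> differentiable h x ->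
  (\forall t \near x, g (f t) = h t) -> 'd g y ('d f x v) = 'd h x v.
Proof.
move=> <- df dg dh gfh.
have e1 := congr1 (@^~ v) (diff_comp df dg).
have e2 := deriveE v (differentiable_comp df dg).
have e3 := @near_eq_derive R V W' (g \o f) h x v gfh.
have e4 := deriveE v dh.
exact: etrans (etrans (etrans (esym e1) (esym e2)) e3) e4.
Qed.

(** * Transition maps and their differentials *)

Section charts.
Context {R : realType} {n : nat} {M : manifold R n}.
Local Notation V := 'rV[R]_n.
Implicit Types (c d e : chart M) (p : M).

Definition cross c d : set V := cmap c @` (cdom c `&` cdom d).

Lemma cross_map c d p : cdom c p -> cdom d p -> cross c d (cmap c p).
Proof. by move=> cp dp; exists p. Qed.

Lemma open_cinv c (O : set M) : open O ->
  open (cmap c @` (cdom c `&` O)).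
Proof.
move=> oO.
have -> : cmap c @` (cdom c `&` O) = (cmap c @` cdom c) `&` cinv c @^-1` O.
  apply/seteqP; split=> [_ [p [cp Op] <-]|_ [[p cp <-]]] /=; rewrite cmapK//.
    by split=> //; exists p.
  by move=> Op; exists p.
have := @cinv_continuous _ _ M c; rewrite continuous_open_subspace;
  last exact: cimg_open.
by move/continuous_inP; apply => //; exact: cimg_open.
Qed.

Lemma open_cross c d : open (cross c d).
Proof. exact/open_cinv/cdom_open. Qed.

Lemma transE c d p : cdom c p -> trans c d (cmap c p) = cmap d p.
Proof. by move=> cp; rewrite /trans /= cmapK. Qed.

Lemma trans_diff c d p : cdom c p -> cdom d p ->
  differentiable (trans c d) (cmap c p).
Proof.
move=> cp dp; exact: smooth_diff (trans_smooth c d) (cross_map cp dp).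
Qed.

Lemma trans_cocycle c d e p (v : V) : cdom c p -> cdom d p -> cdom e p ->
  'd (trans d e) (cmap d p) ('d (trans c d) (cmap c p) v) =
  'd (trans c e) (cmap c p) v.
Proof.
move=> cp dp ep; apply: diff_comp_near (transE d cp) _ _ _ _.
- exact: trans_diff.
- exact: trans_diff.
- exact: trans_diff.
near=> x.
have [q [cq dq] <-] : cross c d x.
  by near: x; apply: open_nbhs_nbhs; split;
    [exact: open_cross|exact: cross_map].
by rewrite (transE d cq) (transE e dq) (transE e cq).
Unshelve. all: end_near. Qed.

Lemma trans_id c p (v : V) : cdom c p -> 'd (trans c c) (cmap c p) v = v.
Proof.
move=> cp; rewrite -deriveE; last exact: trans_diff.
rewrite -[RHS](@derive_id R _ (cmap c p)); apply: near_eq_derive; near=> x.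
have [q cq <-] : (cmap c @` cdom c) x.
  by near: x; apply: open_nbhs_nbhs; split; [exact: cimg_open|exists p].
by rewrite (transE c cq).
Unshelve. all: end_near. Qed.

Definition ncross c d : set (V * V) := fst @^-1` cross c d.

Lemma open_ncross c d : open (ncross c d).
Proof.
by apply: open_comp => [z _|]; [exact: fst_continuous|exact: open_cross].
Qed.

Lemma smooth_trans_fst (U : set (V * V)) c d : open U -> U `<=` ncross c d ->
  smooth_on U (fun z => trans c d z.1).
Proof.
move=> oU Ucd; apply: (smooth_comp (frame_rV n) oU Ucd (f := fst)).
  by apply: smooth_fst => //; exact: smooth_id.
exact: trans_smooth.
Qed.

Lemma smooth_derive_trans_fst (U : set (V * V)) c d v :
  open U -> U `<=` ncross c d ->
  smooth_on U (fun z => 'D_v (trans c d) (z.1)).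
Proof.
move=> oU Ucd; apply: (smooth_comp (frame_rV n) oU Ucd (f := fst) (g :=
  'D_v (trans c d))).
  by apply: smooth_fst => //; exact: smooth_id.
exact/smooth_derive/trans_smooth.
Qed.

Lemma diff_transE c d (x v : V) : cross c d x ->
  'd (trans c d) x v = \sum_k v 0 k *: 'D_(delta_mx 0 k) (trans c d) x.
Proof.
move=> xcd; apply: (diff_frame (frame_rV n)).
exact: smooth_diff (trans_smooth c d) xcd.
Qed.

Lemma smooth_dtrans (U : set (V * V)) c d (v : V * V -> V) :
  open U -> U `<=` ncross c d -> smooth_on U v ->
  smooth_on U (fun z => 'd (trans c d) (z.1) (v z)).
Proof.
move=> oU Ucd sv.
pose f z := \sum_k v z 0 k *: 'D_(delta_mx 0 k) (trans c d) (z.1).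
apply: (@smooth_eq _ _ _ _ f) => // [z /Ucd zcd|]; first by rewrite diff_transE.
apply: smooth_sum => // k _; apply: smoothZ => //; first exact: smooth_coord.
exact: smooth_derive_trans_fst.
Qed.

Lemma smooth_ntrans c d : smooth_on (ncross c d) (ntrans c d).
Proof.
have oN := @open_ncross c d.
apply: smooth_pair => //; first exact: smooth_trans_fst.
by apply: smooth_dtrans => //; apply: smooth_snd => //; exact: smooth_id.
Qed.

(** Product rule for the sum of the components of v times partial derivatives of the transition map.
    Those partial derivatives depend on x alone, so the Hessian sees only the base component of
    u. *)
Lemma derive_dtrans c d z u (v : V * V -> V) : ncross c d z ->
  differentiable v z ->
  'D_u (fun y => 'd (trans c d) (y.1) (v y)) z =
  'd (trans c d) (z.1) ('D_u v z) + bil (hess c d z.1) u.1 (v z).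
Proof.
move=> zcd dv.
pose f k (y : V * V) := v y 0 k *: 'D_(delta_mx 0 k) (trans c d) (y.1).
have -> : 'D_u (fun y => 'd (trans c d) (y.1) (v y)) z = 'D_u (\sum_k f k) z.
  apply: near_eq_derive; near=> y; rewrite fct_sumE diff_transE//.
  by near: y; apply: open_nbhs_nbhs; split; [exact: open_ncross|exact: zcd].
have dg k : differentiable (fun y :
  V * V => 'D_(delta_mx 0 k) (trans c d) (y.1)) z /\
   'D_u (fun y : V * V => 'D_(delta_mx 0 k) (trans c d) (y.1)) z =
   \sum_j u.1 0 j *: hess c d z.1 j k.
  have dD : differentiable ('D_(delta_mx 0 k) (trans c d)) z.1.
    by apply: (smooth_diff (U := cross c d)) => //;
      exact/smooth_derive/trans_smooth.
  have [? ->] := derive_fst u dD; split=> //.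
  by rewrite (diff_frame (frame_rV n)).
have dvk k : differentiable (fun y => v y 0 k) z /\
    'D_u (fun y => v y 0 k) z = 'D_u v z 0 k.
  by apply: (derive_linear u (L := rcoord k)) => //; exact: rcoord_continuous.
have df k : differentiable (f k) z /\
    'D_u (f k) z = 'D_u v z 0 k *: 'D_(delta_mx 0 k) (trans c d) (z.1) +
       v z 0 k *: \sum_j u.1 0 j *: hess c d z.1 j k.
  have [d1 d1E] := dvk k; have [d2 d2E] := dg k.
  have [d3 d3E] := differentiable_scale d1 d2; split=> //.
  by rewrite (deriveE _ d3) d3E -(deriveE _ d1) -(deriveE _ d2) d1E d2E addrC.
rewrite derive_sum => [|k]; last by apply: diff_derivable; have [] := df k.
under eq_bigr do rewrite (df _).2.
rewrite big_split /= diff_transE//; congr (_ + _).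
rewrite /bil exchange_big; apply: eq_bigr => k _; rewrite scaler_sumr.
by apply: eq_bigr => j _; rewrite scalerA mulrC.
Unshelve. all: end_near. Qed.

(** The Jacobian is block triangular: vertical vectors stay vertical, while base vectors acquire the
    Hessian contracted with y, the source of the non-tensorial law of nonlinear connections. *)
Lemma diff_ntrans c d z u : ncross c d z ->
  'd (ntrans c d) z u =
  ('d (trans c d) (z.1) u.1,
   'd (trans c d) (z.1) u.2 + bil (hess c d z.1) u.1 z.2).
Proof.
move=> zcd; have nE : ntrans c d = fun y =>
  (trans c d y.1, 'd (trans c d) (y.1) y.2) by [].
have d1 : differentiable (fun y : V * V => trans c d y.1) z.
  by apply: smooth_diff zcd; apply: smooth_trans_fst => //; exact: open_ncross.
have dsnd : differentiable (snd : V * V -> V) z.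
  by apply: linear_differentiable; exact: snd_continuous.
have d2 : differentiable (fun y : V * V => 'd (trans c d) (y.1) y.2) z.
  apply: smooth_diff zcd; apply: smooth_dtrans => //; first exact: open_ncross.
  by apply: smooth_snd; [exact: open_ncross|apply: smooth_id;
    exact: open_ncross].
rewrite nE diff_pair//; congr pair.
  rewrite -deriveE// (derive_fst u _).2//.
  by apply: (smooth_diff (U := cross c d)) => //; exact: trans_smooth.
rewrite -deriveE// derive_dtrans// (deriveE _ dsnd) diff_lin//.
exact: snd_continuous.
Qed.

Lemma ntransE c d p y : cdom c p ->
  ntrans c d (cmap c p, y) = (cmap d p, 'd (trans c d) (cmap c p) y).
Proof. by move=> cp; rewrite -[in RHS](transE d cp). Qed.

Lemma ntrans_cocycle c d e z : ncross c d z -> ncross c e z ->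
  ntrans d e (ntrans c d z) = ntrans c e z.
Proof.
case: z => x y [p [/= cp dp <-]] [q [/= cq eq qp]].
(* The chart is injective on its domain, so both witnesses are the same point of M. *)
have pq : p = q by rewrite -(cmapK cp) -qp cmapK.
subst q; apply: etrans (congr1 (ntrans d e) (ntransE d y cp)) _.
apply: etrans (ntransE e _ dp) (etrans _ (esym (ntransE e y cp))).
exact: (congr1 (fun w => (cmap e p, w)) (trans_cocycle y cp dp eq)).
Qed.

Lemma ntrans_id c z : ncross c c z -> ntrans c c z = z.
Proof. by case: z => x y [p [/= cp _ <-]]; apply: etrans (ntransE c y cp) _;
  rewrite (trans_id y cp). Qed.

Lemma ncross_ntrans c d e z : ncross c d z -> ncross c e z ->
  ncross d e (ntrans c d z).
Proof.
case: z => x y [p [/= cp dp <-]] [q [/= cq eq qp]].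
have pq : p = q by rewrite -(cmapK cp) -qp cmapK.
by subst q; rewrite /ncross /preimage /mkset (ntransE d y cp); exact: cross_map.
Qed.

Lemma diff_ntrans_cocycle c d e z u : ncross c d z -> ncross c e z ->
  'd (ntrans d e) (ntrans c d z) ('d (ntrans c d) z u) = 'd (ntrans c e) z u.
Proof.
move=> zcd zce; have d1 := smooth_diff (@smooth_ntrans c d) zcd.
have d2 := smooth_diff (@smooth_ntrans d e) (ncross_ntrans zcd zce).
have d3 := smooth_diff (@smooth_ntrans c e) zce.
apply: (diff_comp_near u (erefl _) d1 d2 d3); near=> y;
  rewrite ntrans_cocycle//.
- by near: y; apply: open_nbhs_nbhs; split; [exact: open_ncross|].
- by near: y; apply: open_nbhs_nbhs; split; [exact: open_ncross|].
Unshelve. all: end_near. Qed.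

End charts.

(** * Coordinate images of the conic domain *)

Section domains.
Context {R : realType} {n : nat} {M : manifold R n} (A : conic_dom M).
Local Notation V := 'rV[R]_n.
Implicit Types (c d e : chart M) (v : tangent_bundle M) (z : V * V).
Local Notation dom := (dom A).
Local Notation overlap := (overlap A).

Lemma open_dom c : open (dom c).
Proof. exact: cd_open. Qed.

Lemma overlap_dom c d z : overlap c d z -> dom c z.
Proof. by case. Qed.

Lemma overlapP c d z : overlap c d z ->
  exists v, [/\ cd_set A v, cdom c (tpt v), cdom d (tpt v) &
                z = (cmap c (tpt v), tco v c)].
Proof.
move=> [[v [Av cv] <-]] /=; rewrite (cmapK cv) => dv.
by exists v.
Qed.

Lemma overlap_ncross c d z : overlap c d z -> ncross c d z.
Proof. by move=> /overlapP[v [_ cv dv ->]]; exact: cross_map. Qed.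

Lemma dom_overlap c d z : dom c z -> ncross c d z -> overlap c d z.
Proof.
move=> cz [p [cp dp] pz]; split=> //.
by rewrite -pz (cmapK cp).
Qed.

Lemma dom_ncross c z : dom c z -> ncross c c z.
Proof. by move=> [v [_ cv] <-]; exact: cross_map. Qed.

Lemma overlap_refl c z : dom c z -> overlap c c z.
Proof. by move=> cz; apply: dom_overlap => //; exact: dom_ncross. Qed.

Lemma open_overlap c d : open (overlap c d).
Proof.
rewrite (_ : overlap c d = dom c `&` ncross c d).
  by apply: openI; [exact: open_dom|exact: open_ncross].
apply/seteqP; split=> [z zcd|z [cz zcd]]; last exact: dom_overlap.
by split; [exact: overlap_dom zcd|exact: overlap_ncross].
Qed.

(** The change of coordinates gives the coordinates of the same tangent vector in the other chart,
    so membership in A is preserved. *)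
Lemma dom_ntrans c d z : overlap c d z -> dom d (ntrans c d z).
Proof.
move=> /overlapP[v [Av cv dv ->]]; exists v => //.
apply: etrans (esym (ntransE d (tco v c) cv)).
exact: (congr1 (fun w => (cmap d (tpt v), w)) (tco_trans cv dv)).
Qed.

Lemma overlap_ntrans c d e z : overlap c d z -> overlap c e z ->
  overlap d e (ntrans c d z).
Proof.
move=> zcd zce; apply: dom_overlap (dom_ntrans zcd) _.
by apply: ncross_ntrans; exact: overlap_ncross.
Qed.

Lemma overlap_sym c d z : overlap c d z -> overlap d c (ntrans c d z).
Proof. by move=> zcd; apply:
  overlap_ntrans zcd (overlap_refl (overlap_dom zcd)). Qed.

Lemma ntransK c d z : overlap c d z -> ntrans d c (ntrans c d z) = z.
Proof.
move=> zcd; have zc := dom_ncross (overlap_dom zcd).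
exact: etrans (ntrans_cocycle (overlap_ncross zcd) zc) (ntrans_id zc).
Qed.

Lemma dom_hscale c (l : R) z : 0 < l -> dom c z -> dom c (hscale l z).
Proof. by move=> l0 [v [Av cv] <-]; exists (tscale l v) => //; split=> //;
  exact: cd_conic. Qed.

Lemma overlap_hscale c d (l : R) z : 0 < l ->
  overlap c d z -> overlap c d (hscale l z).
Proof.
move=> l0 zcd; apply: dom_overlap; first exact: dom_hscale (overlap_dom zcd).
exact: overlap_ncross zcd.
Qed.

Lemma hscaleVK (l : R) : 0 < l -> cancel (@hscale R n l) (hscale l^-1).
Proof. by move=> l0 [x y];
  rewrite /hscale /= scalerA mulVf ?gt_eqF// scale1r. Qed.

Lemma overlap_hscaleE c d (l : R) z : 0 < l ->
  overlap c d (hscale l z) <-> overlap c d z.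
Proof.
move=> l0; split; last exact: overlap_hscale.
by move/(overlap_hscale (l := l^-1)); rewrite hscaleVK//; apply;
  rewrite invr_gt0.
Qed.

Lemma ntrans_hscale c d (l : R) z :
  ntrans c d (hscale l z) = hscale l (ntrans c d z).
Proof. by case: z => x y; rewrite /ntrans /hscale /= linearZ. Qed.

End domains.

Lemma diff_ntrans_hscale (R : realType) n (M : manifold R n) (c d : chart M)
    (l : R) z u : ncross c d z ->
  'd (ntrans c d) (hscale l z) (hscale l u) = hscale l ('d (ntrans c d) z u).
Proof.
move=> zcd; apply: etrans (diff_ntrans _ _) _; first exact: zcd.
apply: etrans _ (congr1 (hscale l) (esym (diff_ntrans u zcd))).
by rewrite /hscale /= linearZ bilZr scalerDr.
Qed.

(** * Global extension of local fields *)

(* Extension by zero of a field F given in the coordinates of the chart c, whose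
   support lies over a compact K inside the chart. Hausdorffness of M makes the
   result smooth. L is the action of the changes of coordinates on the fibre W,
   so that functions, vector fields and sections of pi_A^*(TM) are all covered.
     *)
Section extension.
Context {R : realType} {n : nat} {M : manifold R n} (A : conic_dom M).
Local Notation V := 'rV[R]_n.
Context {W : normedModType R}.
Variable L : chart M -> chart M -> V * V -> {linear W -> W}.
Hypothesis L_id : forall c z w, ncross c c z -> L c c z w = w.
Hypothesis L_cocycle : forall c d e z w, ncross c d z -> ncross c e z ->
  L d e (ntrans c d z) (L c d z w) = L c e z w.
Hypothesis L_smooth : forall c d (U : set (V * V)) (f : V * V -> W), open U ->
  U `<=` ncross c d -> smooth_on U f -> smooth_on U (fun z => L c d z (f z)).
Variables (c : chart M) (K : set V).
Hypotheses (cK : compact K) (Kc : K `<=` cmap c @` cdom c).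

Definition ext (F : V * V -> W) (d : chart M) (z : V * V) : W :=
  if pselect (overlap A d c z) then L c d (ntrans d c z) (F (ntrans d c z))
    else 0.

Lemma ext_in F d z : overlap A d c z ->
  ext F d z = L c d (ntrans d c z) (F (ntrans d c z)).
Proof. by rewrite /ext; case: pselect. Qed.

Lemma ext_notin F d z : ~ overlap A d c z -> ext F d z = 0.
Proof. by rewrite /ext; case: pselect. Qed.

Lemma ext_chart F z : dom A c z -> ext F c z = F z.
Proof.
move=> cz; have zcc := dom_ncross cz; rewrite ext_in; last exact: overlap_refl.
have e := ntrans_id zcc.
by apply: etrans (congr1 (fun y => L c c y (F y)) e) _; rewrite L_id.
Qed.

Lemma ext_out F d z : ~ dom A d z -> ext F d z = 0.
Proof. by move=> dz; rewrite ext_notin// => /overlap_dom. Qed.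

(** Both sides are transported from the chart c, so the cocycle identity of L identifies them; off
    the overlap with c both vanish. *)
Lemma ext_trans F d e z : overlap A d e z ->
  ext F e (ntrans d e z) = L d e z (ext F d z).
Proof.
move=> zde; have [zdc|zdc] := pselect (overlap A d c z); last first.
  rewrite [ext F d z]ext_notin// linear0 ext_notin// => zec; apply: zdc.
  have := overlap_ntrans (overlap_sym zde) zec.
  by have -> := ntransK zde.
rewrite !ext_in//; last exact: overlap_ntrans.
have e1 := ntrans_cocycle (overlap_ncross zde) (overlap_ncross zdc).
apply: etrans (congr1 (fun y => L c e y (F y)) e1) _.
set y := ntrans d c z; have yE : ntrans c d y = z := ntransK zdc.
have ycd : overlap A c d y := overlap_sym zdc.
have yce : overlap A c e y := overlap_ntrans zdc zde.
have h := L_cocycle (F y) (overlap_ncross ycd) (overlap_ncross yce).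
exact: etrans (esym h) (congr1 (fun t => L d e t (L c d y (F y))) yE).
Qed.

(** The part of the chart d lying over the complement of K in M. The extension vanishes there, and
    with the overlap with c these points cover the chart. *)
Let off d := [set z | dom A d z /\ ~ (cinv c @` K) (cinv d z.1)].

Let open_off d : open (off d).
Proof.
have cKM : closed (cinv c @` K).
  apply: compact_closed; first exact: mpt_hausdorff.
  apply: continuous_compact => //.
  by apply: continuous_subspaceW Kc _; exact: cinv_continuous.
have -> : off d = dom A d `&`
    fst @^-1` (cmap d @` (cdom d `&` ~` (cinv c @` K))).
  apply/seteqP; split=> z.
    move=> [[v [Av dv] <-]] /=; rewrite (cmapK dv) => vK; split;
      first by exists v.
    by exists (tpt v).
  by move=> [dz /= [p [dp pK] pz]]; split=> //; rewrite -pz (cmapK dp).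
apply: openI; first exact: open_dom.
apply: open_comp => [z _|]; first exact: fst_continuous.
exact/open_cinv/closed_openC.
Qed.

Lemma ext_smooth F d : smooth_on (dom A c) F ->
  (forall z, ~ K z.1 -> F z = 0) -> smooth_on (dom A d) (ext F d).
Proof.
move=> sF FK; apply: smooth_glue => z dz.
have [zdc|zdc] := pselect (overlap A d c z).
  exists (overlap A d c) => //.
  apply: (@smooth_eq _ _ _ _ (fun z =>
    L c d (ntrans d c z) (F (ntrans d c z)))).
  - exact: open_overlap.
  - by move=> y ydc; rewrite ext_in.
  apply: (smooth_comp (frame_prod (frame_rV n) (frame_rV n)) (U' :=
    overlap A c d)
     (f := ntrans d c) (g := fun y => L c d y (F y))).
  - exact: open_overlap.
  - by move=> y; exact: overlap_sym.
  - apply: smooth_subset (@smooth_ntrans _ _ _ d c); exact: overlap_ncross.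
  apply: L_smooth; [exact: open_overlap|exact: overlap_ncross|].
  by apply: smooth_subset sF; exact: overlap_dom.
exists (off d).
  split=> // -[x Kx xz]; apply: zdc; split=> //; rewrite -xz.
  by have [p cp <-] := Kc Kx; rewrite (cmapK cp).
apply: smooth_eq (smooth_cst _ 0); first exact: open_off.
move=> y [dy yK]; have [ydc|?] := pselect (overlap A d c y);
  last by rewrite ext_notin.
rewrite ext_in// FK ?linear0// => Ky; apply: yK.
have [v [_ dv cv yE]] := overlapP ydc.
exists (ntrans d c y).1 => //; rewrite yE (ntransE c _ dv) /=.
by rewrite (cmapK cv) (cmapK dv).
Qed.

(** Q is the effect of scaling by l on the fibre: a power of l for sections, that power composed
    with [hscale] for vector fields. *)
Lemma ext_hom F (l : R) (Q : W -> W) d z : 0 < l -> Q 0 = 0 ->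
  (forall z, dom A c z -> F (hscale l z) = Q (F z)) ->
  (forall z w, overlap A c d z -> L c d (hscale l z) (Q w) = Q (L c d z w)) ->
  ext F d (hscale l z) = Q (ext F d z).
Proof.
move=> l0 Q0 FQ LQ; have [zdc|zdc] := pselect (overlap A d c z); last first.
  by rewrite !ext_notin// => /(overlap_hscaleE _ _ _ _ l0).
rewrite !ext_in//; last exact: overlap_hscale.
rewrite ntrans_hscale FQ ?LQ//; first exact: overlap_sym.
exact: dom_ntrans.
Qed.

End extension.

Section global_extension.
Context {R : realType} {n : nat} {M : manifold R n} (A : conic_dom M).
Local Notation V := 'rV[R]_n.
Variables (c : chart M) (K : set V).
Hypotheses (cK : compact K) (Kc : K `<=` cmap c @` cdom c).

Let Lfun (_ _ : chart M) (_ : V * V) : {linear R -> R} := idfun.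
Let Lvf (d e : chart M) (z : V * V) : {linear (V * V)%type -> (V * V)%type} :=
  'd (ntrans d e) z.
Let Lsec (d e : chart M) (z : V * V) : {linear V -> V} := 'd (trans d e) (z.1).

Let Lvf_id d z w : ncross d d z -> Lvf d d z w = w.
Proof.
move=> zdd; have [p [dp _] pz] := zdd.
apply: etrans (diff_ntrans w zdd) _; case: w => w1 w2 /=;
  rewrite -pz !trans_id//.
congr pair; rewrite -[RHS]addr0; congr (_ + _).
(* Near the point [trans c c] is the identity, so its first derivatives are constant and the Hessian
   vanishes. *)
rewrite (_ : hess _ _ _ = fun _ _ => 0) ?bil0T//.
apply/funext => j; apply/funext => k.
rewrite -(derive_cst (ebase k) (cmap d p) (ebase j)).
apply: near_eq_derive; near=> x.
have [q [dq _] <-] : cross d d x.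
  by near: x; apply: open_nbhs_nbhs; split;
    [exact: open_cross|exact: cross_map].
by rewrite (deriveE _ (trans_diff dq dq)) trans_id.
Unshelve. all: end_near. Qed.

Let Lvf_smooth d e (U : set (V * V)) (f : V * V -> V * V) : open U ->
  U `<=` ncross d e -> smooth_on U f -> smooth_on U (fun z => Lvf d e z (f z)).
Proof.
move=> oU Ude sf; apply: (smooth_differential (frame_prod (frame_rV n)
  (frame_rV n))) => //.
exact: smooth_subset Ude (@smooth_ntrans _ _ _ d e).
Qed.

Let Lsec_id d z w : ncross d d z -> Lsec d d z w = w.
Proof. by move=> [p [dp _] pz]; rewrite /Lsec -pz trans_id. Qed.

Let Lsec_cocycle d e f z w : ncross d e z -> ncross d f z ->
  Lsec e f (ntrans d e z) (Lsec d e z w) = Lsec d f z w.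
Proof.
move=> [p [dp ep] pz] [q [dq fq qz]].
have pq : p = q by rewrite -(cmapK dp) pz -qz cmapK.
subst q; rewrite /Lsec -pz.
have e1 : (ntrans d e z).1 = cmap e p by rewrite -(transE e dp) pz.
exact: etrans (congr1 (fun x =>
  'd (trans e f) x ('d (trans d e) (cmap d p) w)) e1)
  (trans_cocycle w dp ep fq).
Qed.

Variant ext_data (W : normedModType R) (F : V * V -> W) : Prop :=
  ExtData of smooth_on (dom A c) F & (forall z, ~ K z.1 -> F z = 0).

Definition ext_fun (F : V * V -> R) (hF : ext_data F) : smooth_fun A.
Proof.
refine (@SFun _ _ _ _ (ext A Lfun c F) _ _ _).
- by case: hF => sF FK d; exact: (ext_smooth (L := Lfun) _ cK Kc d sF FK).
- by move=> d z; exact: ext_out.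
- by move=> d e z zde; exact: (ext_trans (L := Lfun) _ c F zde).
Defined.

Definition ext_vf (F : V * V -> V * V) (hF : ext_data F) : vector_field A.
Proof.
refine (@VField _ _ _ _ (ext A Lvf c F) _ _ _).
- by case: hF => sF FK d; exact: (ext_smooth (L :=
  Lvf) Lvf_smooth cK Kc d sF FK).
- by move=> d z; exact: ext_out.
- move=> d e z zde; apply: (ext_trans (L := Lvf)) zde => ? ? ? ? ?;
  exact: diff_ntrans_cocycle.
Defined.

Definition ext_sec (F : V * V -> V) (hF : ext_data F) : tm_section A.
Proof.
refine (@TSec _ _ _ _ (ext A Lsec c F) _ _ _).
- case: hF => sF FK d; apply: (ext_smooth (L := Lsec) _ cK Kc d sF FK).
  by move=> ? ? ? f; exact: (smooth_dtrans (v := f)).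
- by move=> d z; exact: ext_out.
- move=> d e z zde; exact: (ext_trans (L := Lsec) Lsec_cocycle c F zde).
Defined.

Lemma ext_funE F hF z : dom A c z -> @ext_fun F hF c z = F z.
Proof. by move=> cz; exact: (ext_chart (L := Lfun) _ F cz). Qed.

Lemma ext_vfE F hF z : dom A c z -> @ext_vf F hF c z = F z.
Proof. by move=> cz; exact: (ext_chart (L := Lvf) Lvf_id F cz). Qed.

Lemma ext_secE F hF z : dom A c z -> @ext_sec F hF c z = F z.
Proof. by move=> cz; exact: (ext_chart (L := Lsec) Lsec_id F cz). Qed.

Lemma ext_vf_linear F G H f hF hG hH hf :
  (forall z, F z = f z *: G z + H z) -> forall d z,
  @ext_vf F hF d z = @ext_fun f hf d z *: @ext_vf G hG d z + @ext_vf H hH d z.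
Proof.
move=> FE d z /=; have [zdc|zdc] := pselect (overlap A d c z).
  by rewrite !ext_in//= FE linearP.
by rewrite !ext_notin// scaler0 addr0.
Qed.

(** The local relation reaches the other charts through the transformation law of X. The axioms of a
    connection require such relations in every chart. *)
Lemma ext_vf_restrict F f (X : vector_field A) hF hf :
  (forall z, dom A c z -> F z = f z *: X c z) -> forall d z,
  @ext_vf F hF d z = @ext_fun f hf d z *: X d z.
Proof.
move=> FE d z /=; have [zdc|zdc] := pselect (overlap A d c z); last first.
  by rewrite !ext_notin// scale0r.
have zcd := overlap_sym zdc; rewrite !ext_in//= FE ?linearZ;
  last exact: dom_ntrans.
by congr (_ *: _); rewrite -(vfield_trans X zcd) (ntransK zdc).
Qed.

Lemma ext_sec_restrict F f (Z : tm_section A) hF hf :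
  (forall z, dom A c z -> F z = f z *: Z c z) -> forall d z,
  @ext_sec F hF d z = @ext_fun f hf d z *: Z d z.
Proof.
move=> FE d z /=; have [zdc|zdc] := pselect (overlap A d c z); last first.
  by rewrite !ext_notin// scale0r.
have zcd := overlap_sym zdc; rewrite !ext_in//= FE ?linearZ;
  last exact: dom_ntrans.
by congr (_ *: _); rewrite -(tsec_trans Z zcd) (ntransK zdc).
Qed.

Lemma ext_vf_hom F hF a :
  (forall l z, 0 < l -> dom A c z -> F (hscale l z) = l `^ a *:
    hscale l (F z)) ->
  vfield_hom a (@ext_vf F hF).
Proof.
move=> FE d z l l0 dz.
apply: (ext_hom (Q := fun u => l `^ a *: hscale l u)) => //.
- by rewrite /hscale /= scaler0; congr pair; rewrite scaler0.
- by move=> y cy; exact: FE.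
move=> y w ycd.
apply: etrans (linearZZ ('d (ntrans c d) (hscale l y)) (l `^ a) (hscale l w)) _.
exact: (congr1 _ (diff_ntrans_hscale l w (overlap_ncross ycd))).
Qed.

Lemma ext_sec_hom F hF a :
  (forall l z, 0 < l -> dom A c z -> F (hscale l z) = l `^ a *: F z) ->
  tsec_hom a (@ext_sec F hF).
Proof.
move=> FE d z l l0 dz.
apply: (ext_hom (Q := fun u => l `^ a *: u)) => //.
- by rewrite scaler0.
- by move=> y cy; exact: FE.
by move=> y w ycd; exact: (linearZZ ('d (trans c d) (y.1))).
Qed.

End global_extension.

(** * Expansion of a connection in cut-off coordinate fields *)

Section cutoff.
Context {R : realType} {n : nat} {M : manifold R n} (A : conic_dom M).
Local Notation V := 'rV[R]_n.
Local Notation F2 := (frame_prod (frame_rV n) (frame_rV n) :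
  frame (V * V)%type).
Variables (c : chart M) (K : set V) (b : V -> R).
Hypotheses (cK : compact K) (Kc : K `<=` cmap c @` cdom c).
Hypotheses (sb : smooth_on setT b) (bK : forall x, ~ K x -> b x = 0).

Lemma cutoff_smooth : smooth_on (dom A c) (fun z => b z.1).
Proof.
apply: (smooth_comp (frame_rV n) (U' := setT) (f := fst)) => //.
  exact: open_dom.
by apply: smooth_fst; [exact: open_dom|apply: smooth_id; exact: open_dom].
Qed.

Lemma cutoff_data0 : ext_data A c K (fun z => b z.1).
Proof. by split=> [|z /bK//]; exact: cutoff_smooth. Qed.

Lemma cutoff_data (W : normedModType R) (G : V * V -> W) :
  smooth_on (dom A c) G -> ext_data A c K (fun z => b z.1 *: G z).
Proof.
move=> sG; split=> [|z /bK->]; last by rewrite scale0r.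
by apply: smoothZ => //; [exact: open_dom|exact: cutoff_smooth].
Qed.

Lemma cutoff_data_sum (W : normedModType R) (I : Type) (s : seq I)
    (G : I -> V * V -> W) : (forall i, smooth_on (dom A c) (G i)) ->
  ext_data A c K (fun z => \sum_(i <- s) b z.1 *: G i z).
Proof.
move=> sG; split=> [|z /bK bz]; last first.
  by rewrite big1// => i _; rewrite bz scale0r.
apply: smooth_sum => [|i _]; first exact: open_dom.
by have [] := cutoff_data (sG i).
Qed.

Definition cut : smooth_fun A := ext_fun cK Kc cutoff_data0.
Definition frame_vf (i : fidx F2) : vector_field A :=
  ext_vf cK Kc (cutoff_data (smooth_cst _ (fvec F2 i))).
Definition frame_sec (k : 'I_n) : tm_section A :=
  ext_sec cK Kc (cutoff_data (smooth_cst _ (ebase k : V))).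

Lemma near_fst (z : V * V) (P : V -> Prop) :
  (\forall x \near z.1, P x) -> \forall y \near z, P y.1.
Proof. by move=> Pz; apply: (@fst_continuous R V V z). Qed.

Lemma near_dom z : dom A c z -> \forall y \near z, dom A c y.
Proof. by move=> cz; apply: open_nbhs_nbhs; split=> //; exact: open_dom. Qed.

Section formula.
Variables (D : lin_conn A) (z : V * V).
Hypotheses (cz : dom A c z) (bz : \forall x \near z.1, b x = 1).

Let bz1 : b z.1 = 1.
Proof. exact: nbhs_singleton bz. Qed.

Let cutz : cut c z = 1.
Proof. by rewrite /cut ext_funE. Qed.

(** For the zero field X, linearity with all three fields equal to X and f = [cut] reads D X Z = D X
    Z + D X Z at z, where [cut] is 1. *)
Let nabla0l (X : vector_field A) Z : (forall d y, X d y = 0) -> D X Z c z = 0.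
Proof.
move=> X0; have /(_ c z) : forall d y, D X Z d y = cut d y *:
  D X Z d y + D X Z d y.
  by apply: nabla_linear_l => d y; rewrite X0 scaler0 addr0.
by rewrite cutz scale1r => /eqP; rewrite eq_sym -subr_eq0 addrK => /eqP.
Qed.

Let ext0_data : ext_data A c K (fun=> 0 : V * V).
Proof. by split=> //; exact: smooth_cst. Qed.

Let vf0 : vector_field A := ext_vf cK Kc ext0_data.
Let vf0E d y : vf0 d y = 0.
Proof.
rewrite /vf0 /= /ext; case: pselect => // ?; exact: linear0.
Qed.

Let nablaZl (f : smooth_fun A) (X W : vector_field A) Z :
  (forall d y, W d y = f d y *: X d y) -> D W Z c z = f c z *: D X Z c z.
Proof.
move=> WE; rewrite (@nabla_linear_l _ _ _ _ D f X vf0 W Z).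
  by rewrite (nabla0l _ vf0E) addr0.
by move=> d y; rewrite vf0E addr0.
Qed.

(** X is replaced by b^2 X, which does not change the value at z. One factor b makes the coefficient
    a global function and the other makes the coordinate vector a global field, so that linearity
    applies to the sum. *)
Lemma nabla_frame_l (X : vector_field A) (Z : tm_section A) :
  D X Z c z = \sum_i fco F2 i (X c z) *: D (frame_vf i) Z c z.
Proof.
have scoord i : smooth_on (dom A c) (fun y => fco F2 i (X c y)).
  apply: smooth_linear; [exact: open_dom|exact: fco_continuous|].
  exact: vfield_smooth.
pose co i : smooth_fun A := ext_fun cK Kc (cutoff_data (scoord i)).
have sG i : smooth_on (dom A c) (fun y => (b y.1 * fco F2 i (X c y)) *:
  fvec F2 i).
  apply: smoothZ; [exact: open_dom| |exact: smooth_cst].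
  by have [] := cutoff_data (scoord i).
have sum_seq s F (hF : ext_data A c K F) :
    (forall y, F y = \sum_(i <- s) b y.1 *: ((b y.1 * fco F2 i (X c y)) *:
      fvec F2 i)) ->
    D (ext_vf cK Kc hF) Z c z = \sum_(i <- s) co i c z *: D (frame_vf i) Z c z.
  elim: s F hF => [|i s IH] F hF FE.
    rewrite big_nil; apply: nabla0l => d y.
    rewrite /= /ext; case: pselect => // ?; rewrite FE big_nil; exact: linear0.
  rewrite big_cons -(IH _ (cutoff_data_sum s sG))//.
  apply: nabla_linear_l => d y; apply: ext_vf_linear => y'.
  by rewrite FE big_cons; congr (_ + _); rewrite scalerA mulrC -scalerA.
have bX_data : ext_data A c K (fun y => b y.1 *: X c y).
  by apply: cutoff_data; exact: vfield_smooth.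
pose bX := ext_vf cK Kc bX_data.
have bX_smooth : smooth_on (dom A c) (fun y => b y.1 *: X c y) by have [] :=
  bX_data.
pose bbX := ext_vf cK Kc (cutoff_data bX_smooth).
have <- : D bX Z c z = D X Z c z.
  rewrite (@nablaZl cut X bX) ?cutz ?scale1r// => d y.
  exact: ext_vf_restrict.
have <- : D bbX Z c z = D bX Z c z.
  rewrite (@nablaZl cut bX bbX) ?cutz ?scale1r// => d y.
  apply: ext_vf_restrict => y' cy'; rewrite /bX ext_vfE//.
rewrite (sum_seq (index_enum _)) => [|y].
  apply: eq_bigr => i _; rewrite /co ext_funE//.
  by rewrite bz1 scale1r.
rewrite {1}(fco_sum F2 (X c y)) !scaler_sumr; apply: eq_bigr => i _.
by congr (_ *: _); rewrite scalerA.
Qed.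

Let derive_cut u (W : normedModType R) (G : V * V -> W) :
  'D_u (fun y => b y.1 *: G y) z = 'D_u G z.
Proof.
apply: near_eq_derive; near=> y.
have -> : b y.1 = 1 by near: y; exact: near_fst bz.
by rewrite scale1r.
Unshelve. all: end_near. Qed.

(** [cut] is constant near z, so the derivative term of the Leibniz rule drops out. *)
Let nabla_cut (X : vector_field A) (Z W : tm_section A) :
  (forall d y, W d y = cut d y *: Z d y) -> D X W c z = D X Z c z.
Proof.
move=> WE; rewrite (nabla_leibniz D X WE)// cutz scale1r.
have -> : 'D_(X c z) (cut c) z = 0; last by rewrite scale0r addr0.
rewrite -(derive_cst (1 : R) z (X c z)); apply: near_eq_derive; near=> y.
have cy : dom A c y by near: y; exact: near_dom.
by rewrite /cut ext_funE//; near: y; exact: near_fst bz.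
Unshelve. all: end_near. Qed.

(** As on the left, b^2 Z is a finite combination of global sections. The Leibniz rule now also
    differentiates the coefficients, and these derivatives assemble into the directional derivative
    of Z. *)
Lemma nabla_frame_r (X : vector_field A) (Z : tm_section A) :
  D X Z c z = 'D_(X c z) (Z c) z + \sum_k Z c z 0 k *: D X (frame_sec k) c z.
Proof.
have scoord k : smooth_on (dom A c) (fun y => Z c y 0 k).
  by apply: smooth_coord; [exact: open_dom|exact: tsec_smooth].
pose co k : smooth_fun A := ext_fun cK Kc (cutoff_data (scoord k)).
have sG k : smooth_on (dom A c) (fun y => (b y.1 * Z c y 0 k) *: ebase k).
  apply: smoothZ; [exact: open_dom| |exact: smooth_cst].
  by have [] := cutoff_data (scoord k).
have dZ : differentiable (Z c) z by apply: smooth_diff cz; exact: tsec_smooth.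
have co_derive k : 'D_(X c z) (co k c) z = 'D_(X c z) (Z c) z 0 k.
  have [_ dE] := derive_linear (X c z) (L :=
    rcoord k) (@rcoord_continuous R n k) dZ.
  apply: etrans _ dE.
  rewrite -[RHS]derive_cut; apply: near_eq_derive; near=> y.
  by rewrite /co ext_funE//; near: y; exact: near_dom.
have sum_seq s F (hF : ext_data A c K F) :
    (forall y, F y = \sum_(k <- s) b y.1 *: ((b y.1 * Z c y 0 k) *: ebase k)) ->
    D X (ext_sec cK Kc hF) c z =
    \sum_(k <- s) (co k c z *:
      D X (frame_sec k) c z + 'D_(X c z) (Z c) z 0 k *: ebase k).
  elim: s F hF => [|k s IH] F hF FE.
    have F0 d y : ext_sec cK Kc hF d y = 0.
      by rewrite /= /ext; case: pselect => // ?; rewrite FE big_nil;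
        exact: linear0.
    (* The zero section satisfies Y = Y + Y, so additivity forces its derivative to vanish. *)
    have /(_ _ c z)/eqP := @nabla_add_r _ _ _ _ D X (ext_sec cK Kc hF)
       (ext_sec cK Kc hF) (ext_sec cK Kc hF).
    rewrite big_nil eq_sym -subr_eq0 addrK => h; apply/eqP/h => d y.
    by rewrite F0 addr0.
  rewrite big_cons -(IH _ (cutoff_data_sum s sG))//.
  pose Y := ext_sec cK Kc (cutoff_data (sG k)).
  rewrite (@nabla_add_r _ _ _ _ D X Y (ext_sec cK Kc (cutoff_data_sum s sG)));
    last first.
    move=> d y; rewrite /= /ext; case: pselect => [?|?]; last by rewrite addr0.
    by rewrite -linearD FE big_cons.
  congr (_ + _); rewrite (nabla_leibniz D X (f := co k) (Z := frame_sec k))//.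
    rewrite co_derive; congr (_ + _ *: _); rewrite /frame_sec ext_secE//.
    by rewrite bz1 scale1r.
  move=> d y; apply: ext_sec_restrict => y' cy'.
  by rewrite /frame_sec ext_secE// !scalerA mulrC.
have bZ_data : ext_data A c K (fun y => b y.1 *: Z c y).
  by apply: cutoff_data; exact: tsec_smooth.
pose bZ := ext_sec cK Kc bZ_data.
have bZ_smooth : smooth_on (dom A c) (fun y => b y.1 *: Z c y) by have [] :=
  bZ_data.
pose bbZ := ext_sec cK Kc (cutoff_data bZ_smooth).
have <- : D X bZ c z = D X Z c z.
  by apply: nabla_cut => d y; exact: ext_sec_restrict.
have <- : D X bbZ c z = D X bZ c z.
  apply: nabla_cut => d y; apply: ext_sec_restrict => y' cy';
    rewrite /bZ ext_secE//.
rewrite (sum_seq (index_enum _)) => [|y].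
  have coz k : co k c z = Z c z 0 k by rewrite /co ext_funE// bz1 scale1r.
  under eq_bigr do rewrite coz.
  by rewrite big_split /= addrC; congr (_ + _); exact/esym/row_sum_delta.
rewrite {1}(row_sum_delta (Z c y)) !scaler_sumr; apply: eq_bigr => k _.
by congr (_ *: _); rewrite scalerA.
Unshelve. all: end_near. Qed.

End formula.

End cutoff.

(** * The coefficients of a connection *)

Section coefficients.
Context {R : realType} {n : nat} {M : manifold R n} (A : conic_dom M).
Local Notation V := 'rV[R]_n.
Local Notation F2 := (frame_prod (frame_rV n) (frame_rV n) :
  frame (V * V)%type).

Lemma cutoff_exists (c : chart M) z : dom A c z ->
  exists (K : set V) (b : V -> R),
  [/\ compact K, K `<=` cmap c @` cdom c, smooth_on setT b,
      \forall x \near z.1, b x = 1 & forall x, ~ K x -> b x = 0].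
Proof.
by move=> [v [_ cv] <-]; apply: bump_exists; [exact: cimg_open|exists (tpt v)].
Qed.

Definition omega (g1 g2 : @array R n) (u : V * V) (w : V) : V :=
  bil g1 u.1 w + bil g2 u.2 w.

Lemma omegaPl g1 g2 a u u' w :
  omega g1 g2 (a *: u + u') w = a *: omega g1 g2 u w + omega g1 g2 u' w.
Proof. by rewrite /omega /= !bilPl scalerDr addrACA. Qed.

Lemma omegaPr g1 g2 a u w w' :
  omega g1 g2 u (a *: w + w') = a *: omega g1 g2 u w + omega g1 g2 u w'.
Proof. by rewrite /omega /= !bilPr scalerDr addrACA. Qed.

Lemma omega_smooth (W : normedModType R) (U : set W) (g1 g2 : W -> @array R n)
    (u : W -> V * V) (w : W -> V) : open U ->
  (forall j k, smooth_on U (fun z => g1 z j k)) ->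
  (forall j k, smooth_on U (fun z => g2 z j k)) ->
  smooth_on U u -> smooth_on U w ->
  smooth_on U (fun z => omega (g1 z) (g2 z) (u z) (w z)).
Proof.
move=> oU s1 s2 su sw; apply: smoothD => //; apply: smooth_bil => //.
- exact: smooth_fst.
- exact: smooth_snd.
Qed.

Let frame_omega (C : fidx F2 -> 'I_n -> V) (u : V * V) (w : V) :
  \sum_k w 0 k *: (\sum_i fco F2 i u *: C i k) =
  omega (fun j k => C (inl j) k) (fun j k => C (inr j) k) u w.
Proof.
rewrite /omega /bil.
under eq_bigr do rewrite scaler_sumr big_sumType /=.
rewrite big_split /= exchange_big; congr (_ + _).
  by apply: eq_bigr => j _; apply: eq_bigr => k _; rewrite scalerA mulrC.
rewrite exchange_big.
by apply: eq_bigr => j _; apply: eq_bigr => k _; rewrite scalerA mulrC.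
Qed.

Let nabla_omega (D : lin_conn A) c z : dom A c z -> exists g1 g2 : @array R n,
  forall (X : vector_field A) (Z : tm_section A),
  D X Z c z = 'D_(X c z) (Z c) z + omega g1 g2 (X c z) (Z c z).
Proof.
move=> cz; have [K [b [cK Kc sb bz bK]]] := cutoff_exists cz.
pose C i k := D (frame_vf A cK Kc sb bK i) (frame_sec A cK Kc sb bK k) c z.
exists (fun j k => C (inl j) k), (fun j k => C (inr j) k) => X Z.
rewrite -(frame_omega C) (nabla_frame_r cK Kc sb bK D cz bz); congr (_ + _).
by apply: eq_bigr => k _; rewrite -(nabla_frame_l cK Kc sb bK D cz bz).
Qed.

(** Cutting off G and H provides witnesses for [xget]. The witness chosen is irrelevant, since the
    formula involves the fields only through their germs at z. *)
Let local_nabla_omega (D : lin_conn A) c z g1 g2 G H : dom A c z ->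
  (forall (X : vector_field A) (Z : tm_section A),
    D X Z c z = 'D_(X c z) (Z c) z + omega g1 g2 (X c z) (Z c z)) ->
  smooth_on (dom A c) G -> smooth_on (dom A c) H ->
  local_nabla D c z G H = 'D_(G z) H z + omega g1 g2 (G z) (H z).
Proof.
move=> cz DE sG sH; have [K [b [cK Kc sb bz bK]]] := cutoff_exists cz.
rewrite /local_nabla; set S := [set w | _].
have nb : \forall y \near z, b y.1 = 1 by exact: near_fst bz.
have nd := near_dom cz.
have /(xgetPex 0) : exists w, S w.
  pose X := ext_vf cK Kc (cutoff_data sb bK sG).
  pose Z := ext_sec cK Kc (cutoff_data sb bK sH).
  exists (D X Z c z); split=> //; exists X, Z; split=> //.
    near=> y; rewrite /X ext_vfE; last by near: y.
    by have -> : b y.1 = 1; [near: y|rewrite scale1r].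
  near=> y; rewrite /Z ext_secE; last by near: y.
  by have -> : b y.1 = 1; [near: y|rewrite scale1r].
move=> [_ [X [Z [XG ZH ->]]]].
rewrite DE (near_eq_derive _ ZH).
by rewrite (nbhs_singleton XG) (nbhs_singleton ZH).
Unshelve. all: end_near. Qed.

(** Constant coordinate fields have no derivative term, so they isolate the entries of the
    arrays. *)
Lemma gamma_unique (D : lin_conn A) c z g1 g2 : dom A c z ->
  (forall (X : vector_field A) (Z : tm_section A),
    D X Z c z = 'D_(X c z) (Z c) z + omega g1 g2 (X c z) (Z c z)) ->
  gamma1 D c z = g1 /\ gamma2 D c z = g2.
Proof.
move=> cz DE; split; apply/funext => j; apply/funext => k.
- rewrite /gamma1 (local_nabla_omega cz DE); [|exact: smooth_cst..].
  by rewrite derive_cst add0r /omega /= bil0l addr0 bil_base.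
- rewrite /gamma2 (local_nabla_omega cz DE); [|exact: smooth_cst..].
  by rewrite derive_cst add0r /omega /= bil0l add0r bil_base.
Qed.

Definition conn_form (D : lin_conn A) c z :=
  omega (gamma1 D c z) (gamma2 D c z).

Lemma nablaE (D : lin_conn A) c z X Z : dom A c z ->
  D X Z c z = 'D_(X c z) (Z c) z + conn_form D c z (X c z) (Z c z).
Proof.
move=> cz; have [g1 [g2 DE]] := nabla_omega D cz.
by have [e1 e2] := gamma_unique cz DE; rewrite /conn_form e1 e2.
Qed.

Lemma local_nablaE (D : lin_conn A) c z G H : dom A c z ->
  smooth_on (dom A c) G -> smooth_on (dom A c) H ->
  local_nabla D c z G H = 'D_(G z) H z + conn_form D c z (G z) (H z).
Proof.
move=> cz; apply: local_nabla_omega => // X Z; exact: nablaE.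
Qed.

Lemma local_nabla_out (D : lin_conn A) c z G H : ~ dom A c z ->
  local_nabla D c z G H = 0.
Proof. by move=> cz; apply: xgetPN => w [/cz]. Qed.

Section frame.
Variables (D : lin_conn A) (c : chart M) (K : set V) (b : V -> R).
Hypotheses (cK : compact K) (Kc : K `<=` cmap c @` cdom c).
Hypotheses (sb : smooth_on setT b) (bK : forall x, ~ K x -> b x = 0).
Variable z : V * V.
Hypotheses (cz : dom A c z) (bz : \forall x \near z.1, b x = 1).

(** Exhibits the connection form as a component of a global section, which is how its smoothness,
    homogeneity and transformation law are derived. *)
Lemma nabla_ext_cst u w :
  D (ext_vf cK Kc (cutoff_data sb bK (smooth_cst (dom A c) u)))
    (ext_sec cK Kc (cutoff_data sb bK (smooth_cst (dom A c) w))) c z =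
  conn_form D c z u w.
Proof.
have bz1 : b z.1 = 1 by exact: nbhs_singleton bz.
rewrite nablaE// ext_vfE// ext_secE// bz1 !scale1r -[RHS]add0r; congr (_ + _).
rewrite -(derive_cst w z u); apply: near_eq_derive; near=> y.
rewrite ext_secE; last by near: y; exact: near_dom.
by have -> : b y.1 = 1; [near: y; exact: near_fst bz|rewrite scale1r].
Unshelve. all: end_near. Qed.

End frame.

Lemma conn_form_smooth (D : lin_conn A) c u w :
  smooth_on (dom A c) (fun z => conn_form D c z u w).
Proof.
apply: smooth_glue => z0 cz0;
  have [K [b [cK Kc sb bz bK]]] := cutoff_exists cz0.
pose O := dom A c `&` fst @^-1` [set x | b x = 1]°.
have oO : open O.
  apply: openI; first exact: open_dom.
  apply: open_comp => [z _|]; first exact: fst_continuous.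
  exact: open_interior.
exists O; first by split.
apply: smooth_eq (smooth_subset (_ : O `<=` dom A c) (tsec_smooth (D
  (ext_vf cK Kc (cutoff_data sb bK (smooth_cst (dom A c) u)))
  (ext_sec cK Kc (cutoff_data sb bK (smooth_cst (dom A c) w)))) c)) => //.
- by move=> z [cz zb]; rewrite nabla_ext_cst.
- by move=> z [].
Qed.

Lemma conn_form_base (D : lin_conn A) c z j k :
  gamma1 D c z j k = conn_form D c z (delta_mx 0 j, 0) (delta_mx 0 k) /\
  gamma2 D c z j k = conn_form D c z (0, delta_mx 0 j) (delta_mx 0 k).
Proof.
by rewrite /conn_form /omega /= !bil0l add0r addr0 !bil_base.
Qed.

Lemma gamma1_smooth (D : lin_conn A) c j k :
  smooth_on (dom A c) (fun z => gamma1 D c z j k).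
Proof.
apply: smooth_eq (conn_form_smooth D c (delta_mx 0 j, 0) (delta_mx 0 k)).
  exact: open_dom.
by move=> z _; rewrite -(conn_form_base D c z j k).1.
Qed.

Lemma gamma2_smooth (D : lin_conn A) c j k :
  smooth_on (dom A c) (fun z => gamma2 D c z j k).
Proof.
apply: smooth_eq (conn_form_smooth D c (0, delta_mx 0 j) (delta_mx 0 k)).
  exact: open_dom.
by move=> z _; rewrite -(conn_form_base D c z j k).2.
Qed.

(* The cutoff depends on x only, so the extensions of homogeneous fields are
   homogeneous. *)
Lemma conn_form_hom (D : lin_conn A) c z l a u w : 0 < l -> dom A c z ->
  (forall l, 0 < l -> u = l `^ a *: hscale l u) ->
  conn_form D c (hscale l z) u w = l `^ a *: conn_form D c z u w.
Proof.
move=> l0 cz uE; have [K [b [cK Kc sb bz bK]]] := cutoff_exists cz.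
have clz : dom A c (hscale l z) by exact: dom_hscale.
rewrite -(nabla_ext_cst D cK Kc sb bK clz bz) -(nabla_ext_cst D cK Kc sb bK cz
  bz).
rewrite -(addr0 a); apply: nabla_hom => //.
- apply: ext_vf_hom => l' y l'0 cy /=;
  rewrite [in LHS](uE _ l'0) scalerA mulrC -scalerA.
  by congr (_ *: _); rewrite /hscale /= scalerA mulrC -scalerA.
- by apply: ext_sec_hom => l' y l'0 cy /=; rewrite powRr0 scale1r.
Qed.

Lemma gamma1_hom (D : lin_conn A) c z l j k : 0 < l -> dom A c z ->
  gamma1 D c (hscale l z) j k = gamma1 D c z j k.
Proof.
move=> l0 cz; rewrite !(conn_form_base _ _ _ _ _).1 (@conn_form_hom D c z l
  0)//.
  by rewrite powRr0 scale1r.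
by move=> l' _; rewrite powRr0 scale1r /hscale /= scaler0.
Qed.

(** A vertical coordinate field has degree -1: scaling multiplies its component by l, which the
    factor l^-1 undoes. *)
Lemma gamma2_hom (D : lin_conn A) c z l j k : 0 < l -> dom A c z ->
  gamma2 D c (hscale l z) j k = l `^ (-1) *: gamma2 D c z j k.
Proof.
move=> l0 cz; rewrite !(conn_form_base _ _ _ _ _).2 (@conn_form_hom D c z l
  (-1))//.
move=> l' l'0; rewrite powR_inv1 ?ltW// /hscale /=; congr pair.
  by rewrite /= scaler0.
by rewrite /= scalerA mulVf ?gt_eqF// scale1r.
Qed.

(** Differentiates the transformation law of Z along u, by the chain rule on one side and the
    product rule on the other. *)
Lemma derive_section (Z : tm_section A) c d z u : overlap A c d z ->
  'D_('d (ntrans c d) z u) (Z d) (ntrans c d z) =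
  'd (trans c d) (z.1) ('D_u (Z c) z) + bil (hess c d z.1) u.1 (Z c z).
Proof.
move=> zcd; have dZ e y : dom A e y -> differentiable (Z e) y.
  by move=> ey; apply: smooth_diff ey; exact: tsec_smooth.
have dn := smooth_diff (@smooth_ntrans _ _ _ c d) (overlap_ncross zcd).
have dZd := dZ d _ (dom_ntrans zcd).
rewrite (deriveE _ dZd).
pose h (y : V * V) := 'd (trans c d) (y.1) (Z c y).
have dh : differentiable h z.
  apply: smooth_diff (zcd : overlap A c d z).
  apply: smooth_dtrans; [exact: open_overlap|exact: overlap_ncross|].
  by apply: smooth_subset (tsec_smooth Z c); exact: overlap_dom.
rewrite (@diff_comp_near R _ _ _ (ntrans c d) (Z d) h z _ u (erefl _) dn dZd
  dh).
  rewrite -(deriveE _ dh) derive_dtrans//; first exact: overlap_ncross zcd.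
  exact/dZ/overlap_dom/zcd.
near=> y; apply: tsec_trans.
by near: y; apply: open_nbhs_nbhs; split; [exact: open_overlap|].
Unshelve. all: end_near. Qed.

(** The derivative of cut-off constant fields is computed in both charts. A section constant in c is
    not constant in d, and its derivative there is the Hessian term. *)
Lemma conn_form_trans (D : lin_conn A) c d z u w : overlap A c d z ->
  'd (trans c d) (z.1) (conn_form D c z u w) =
  conn_form D d (ntrans c d z) ('d (ntrans c d) z u) ('d (trans c d) (z.1) w)
  + bil (hess c d z.1) u.1 w.
Proof.
move=> zcd; have cz := overlap_dom zcd.
have [K [b [cK Kc sb bz bK]]] := cutoff_exists cz.
have bz1 : b z.1 = 1 by exact: nbhs_singleton bz.
pose X := ext_vf cK Kc (cutoff_data sb bK (smooth_cst (dom A c) u)).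
pose Z := ext_sec cK Kc (cutoff_data sb bK (smooth_cst (dom A c) w)).
have Xz : X c z = u by rewrite /X ext_vfE// bz1 scale1r.
have Zz : Z c z = w by rewrite /Z ext_secE// bz1 scale1r.
rewrite -(nabla_ext_cst D cK Kc sb bK cz bz) -/X -/Z.
have DXZ := nabla_ext_cst D cK Kc sb bK cz bz u w.
(* Comes from comparing the general formula with its value on cut-off constants. *)
have dZ0 : 'D_u (Z c) z = 0.
  move: DXZ; rewrite -/X -/Z nablaE// Xz Zz => /eqP.
  by rewrite -subr_eq0 addrK => /eqP.
rewrite -(tsec_trans _ zcd) nablaE; last exact: dom_ntrans.
rewrite (vfield_trans X zcd) (tsec_trans Z zcd) Xz Zz derive_section// dZ0 Zz.
by rewrite linear0 add0r addrC.
Qed.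

End coefficients.

(** * Equality of objects from equality of components *)

Section extensionality.
Context {R : realType} {n : nat} {M : manifold R n} {A : conic_dom M}.

Lemma tsec_ext (Y Z : tm_section A) :
  (forall c z, dom A c z -> Y c z = Z c z) -> Y = Z.
Proof.
case: Y => y sy oy ty; case: Z => z sz oz tz /= yz.
have e : y = z.
  apply/funext => c; apply/funext => u.
  by have [/yz//|uc] := pselect (dom A c u); rewrite oy// oz.
by subst y; congr TSec; exact: Prop_irrelevance.
Qed.

Lemma canis_ext (G H : anis_conn A) :
  (forall c z j k, dom A c z -> G c z j k = H c z j k) -> G = H.
Proof.
case: G => g sg og tg hg; case: H => h sh oh th hh /= gh.
have e : g = h.
  apply/funext => c; apply/funext => z; apply/funext => j; apply/funext => k.
  by have [/gh//|zc] := pselect (dom A c z); rewrite og// oh.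
by subst g; congr CAnis; exact: Prop_irrelevance.
Qed.

Lemma tens_ext (S T : htensor12 A) :
  (forall c z j k, dom A c z -> S c z j k = T c z j k) -> S = T.
Proof.
case: S => g sg og tg hg; case: T => h sh oh th hh /= gh.
have e : g = h.
  apply/funext => c; apply/funext => z; apply/funext => j; apply/funext => k.
  by have [/gh//|zc] := pselect (dom A c z); rewrite og// oh.
by subst g; congr Tens; exact: Prop_irrelevance.
Qed.

Lemma cnl_ext (N P : nonlin_conn A) :
  (forall c z i, dom A c z -> N c z i = P c z i) -> N = P.
Proof.
case: N => g sg og tg hg; case: P => h sh oh th hh /= gh.
have e : g = h.
  apply/funext => c; apply/funext => z; apply/funext => j.
  by have [/gh//|zc] := pselect (dom A c z); rewrite og// oh.
by subst g; congr CNl; exact: Prop_irrelevance.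
Qed.

Lemma lin_conn_ext (D E : lin_conn A) :
  (forall c z, dom A c z ->
    gamma1 D c z = gamma1 E c z /\ gamma2 D c z = gamma2 E c z) -> D = E.
Proof.
move=> DE; have e : nabla D = nabla E.
  apply/funext => X; apply/funext => Z; apply: tsec_ext => c z cz.
  by rewrite !nablaE// /conn_form; have [-> ->] := DE _ _ cz.
move: e {DE}; case: D => d d1 d2 d3 d4; case: E => e e1 e2 e3 e4 /= de.
by subst d; congr CLin; exact: Prop_irrelevance.
Qed.

Lemma reg_lin_conn_ext (D E : reg_lin_conn A) :
  creg_val D = creg_val E -> D = E.
Proof.
case: D => d hd; case: E => e he /= de.
by subst d; congr CReg; exact: Prop_irrelevance.
Qed.

Lemma adm_htensor12_ext (S T : adm_htensor12 A) :
  tens_adm_val S = tens_adm_val T -> S = T.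
Proof.
case: S => d hd; case: T => e he /= de.
by subst d; congr TensAdm; exact: Prop_irrelevance.
Qed.

End extensionality.

(** * Connections with given coefficients *)

Section construction.
Context {R : realType} {n : nat} {M : manifold R n} {A : conic_dom M}.
Local Notation V := 'rV[R]_n.
Variables (g1 g2 : chart M -> V * V -> @array R n).
Hypothesis g1_smooth : forall c j k, smooth_on (dom A c) (fun z => g1 c z j k).
Hypothesis g2_smooth : forall c j k, smooth_on (dom A c) (fun z => g2 c z j k).
Local Notation om c z := (omega (g1 c z) (g2 c z)).
Hypothesis om_trans : forall c d z u w, overlap A c d z ->
  'd (trans c d) (z.1) (om c z u w) =
  om d (ntrans c d z) ('d (ntrans c d) z u) ('d (trans c d) (z.1) w)
  + bil (hess c d z.1) u.1 w.
Hypothesis g1_hom : forall c z l j k, 0 < l -> dom A c z ->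
  g1 c (hscale l z) j k = g1 c z j k.
Hypothesis g2_hom : forall c z l j k, 0 < l -> dom A c z ->
  g2 c (hscale l z) j k = l `^ (-1) *: g2 c z j k.

Let nab (X : vector_field A) (Z : tm_section A) (c : chart M) (z : V * V) : V :=
  if pselect (dom A c z) then 'D_(X c z) (Z c) z + om c z (X c z) (Z c z) else
    0.

Let nabE X Z c z : dom A c z ->
  nab X Z c z = 'D_(X c z) (Z c) z + om c z (X c z) (Z c z).
Proof. by rewrite /nab; case: pselect. Qed.

Let nab_out X Z c z : ~ dom A c z -> nab X Z c z = 0.
Proof. by rewrite /nab; case: pselect. Qed.

Let dsec (Z : tm_section A) c z : dom A c z -> differentiable (Z c) z.
Proof. by move=> cz; apply: smooth_diff cz; exact: tsec_smooth. Qed.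

(** The Hessian produced by differentiating a section in another chart is the one in [om_trans], so
    the sum transforms as a section. *)
Definition nabla_sec (X : vector_field A) (Z : tm_section A) : tm_section A.
Proof.
refine (@TSec _ _ _ _ (nab X Z) _ _ _).
- move=> c; have od : open (dom A c) by exact: open_dom.
  apply: (@smooth_eq _ _ _ _ (fun z =>
    'd (Z c) z (X c z) + om c z (X c z) (Z c z))).
  + by [].
  + by move=> z cz; rewrite nabE// deriveE//; exact: dsec.
  apply: smoothD => //.
    apply: (smooth_differential (frame_prod (frame_rV n) (frame_rV n))) => //.
      exact: tsec_smooth.
    exact: vfield_smooth.
  by apply: omega_smooth => //; [exact: vfield_smooth|exact: tsec_smooth].
- by move=> c z; exact: nab_out.
- move=> c d z zcd; rewrite !nabE; last 2 first.
  + exact: overlap_dom zcd.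
  + exact: dom_ntrans.
  rewrite (vfield_trans X zcd) (tsec_trans Z zcd) derive_section// linearD
    om_trans//.
  exact: etrans (esym (addrA _ _ _)) (congr1 _ (addrC _ _)).
Defined.

(** Differentiates the homogeneity relation of Z, which holds on a whole neighbourhood of z. *)
Let sec_hscale (Z : tm_section A) b c z l u :
  tsec_hom b Z -> 0 < l -> dom A c z ->
  'd (Z c) (hscale l z) (hscale l u) = l `^ b *: 'd (Z c) z u.
Proof.
move=> Zb l0 cz; have clz := dom_hscale l0 cz.
have dh : differentiable (@hscale R n l) z /\ 'd (@hscale R n l) z u = hscale l
  u.
  have cf := @fst_continuous R V V; have cs := @snd_continuous R V V.
  have df : differentiable (fst : V * V -> V) z by exact:
    (linear_differentiable (f := fst)).
  have ds : differentiable (snd : V * V -> V) z by exact: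
    (linear_differentiable (f := snd)).
  have dl := differentiableZ l ds.
  split; first exact: (differentiable_pair df dl).
  apply: etrans (congr1 (@^~ u) (diff_pair df dl)) _.
  have e1 : 'd (fst : V * V -> V) z u = u.1 := congr1 (@^~ u) (diff_lin z cf).
  have e2 : 'd (snd : V * V -> V) z u = u.2 := congr1 (@^~ u) (diff_lin z cs).
  have e3 := congr1 (@^~ u) (diffZ l ds).
  exact: (f_equal2 (fun p q :
    V => (p, q)) e1 (etrans e3 (congr1 (fun t => l *: t) e2))).
have [d1 d1E] := dh.
have d3 : differentiable (fun y => l `^ b *: Z c y) z.
  exact: (differentiableZ (l `^ b) (dsec Z cz)).
have near_hom : \forall y \near z, Z c (hscale l y) = l `^ b *: Z c y.
  by near=> y; apply: Zb => //; near: y; exact: near_dom.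
have e := @diff_comp_near R _ _ _ (@hscale R n l) (Z c) (fun y => l `^ b *:
  Z c y)
  z _ u (erefl _) d1 (dsec Z clz) d3 near_hom.
have e' := congr1 (@^~ u) (diffZ (l `^ b) (dsec Z cz)).
exact: etrans (congr1 ('d (Z c) (hscale l z)) (esym d1E)) (etrans e e').
Unshelve. all: end_near. Qed.

Definition mk_conn : lin_conn A.
Proof.
refine (@CLin _ _ _ _ nabla_sec _ _ _ _).
- move=> f X Y W Z WE c z /=; have [cz|cz] := pselect (dom A c z); last first.
    by rewrite !nab_out// scaler0 addr0.
  have dZ := dsec Z cz.
  rewrite !nabE// WE (deriveE _ dZ) (deriveE (X c z) dZ) (deriveE (Y c z) dZ).
  by rewrite linearPZ omegaPl [in RHS]scalerDr addrACA.
- move=> X Y Z W WE c z /=; have [cz|cz] := pselect (dom A c z); last first.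
    by rewrite !nab_out// addr0.
  have dY := diff_derivable (v := X c z) (dsec Y cz).
  have dZ := diff_derivable (v := X c z) (dsec Z cz).
  have WcE : W c = Y c + Z c by exact/funext/WE.
  rewrite !nabE// WE WcE (deriveD dY dZ) -[in omega _ _ _ _](scale1r (Y c z)).
  by rewrite omegaPr scale1r addrACA.
- move=> f X Z W WE c z cz /=; rewrite !nabE// WE.
  have df : differentiable (f c) z by apply: smooth_diff cz; exact: sfun_smooth.
  have [d1 d1E] := differentiable_scale df (dsec Z cz).
  have -> : W c = fun y => f c y *: Z c y by exact/funext/WE.
  rewrite (deriveE _ d1) d1E (deriveE _ df) (deriveE _ (dsec Z cz)).
  rewrite -[in omega _ _ _ _](addr0 (f c z *: Z c z)) omegaPr.
  have om0 u : om c z u 0 = 0 by rewrite /omega !bil0r addr0.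
  by rewrite om0 addr0 [in RHS]scalerDr addrAC.
- move=> a b X Z Xa Zb c z l l0 cz /=; have clz := dom_hscale l0 cz.
  have dZ := dsec Z cz; have dlZ := dsec Z clz.
  set u := X c z; set w := Z c z.
  have e1 : 'd (Z c) (hscale l z) (l `^ a *: hscale l u) =
      l `^ a *: (l `^ b *: 'd (Z c) z u).
    exact: etrans (linearZZ ('d (Z c) (hscale l z)) _ _)
      (congr1 (fun t => l `^ a *: t) (sec_hscale u Zb l0 cz)).
  (* The degree -1 of [g2] compensates the factor l that [hscale] puts on the vertical component. *)
  have e2 : om c (hscale l z) (l `^ a *: hscale l u) (l `^ b *: w) =
      l `^ a *: (l `^ b *: om c z u w).
    have -> : g1 c (hscale l z) = g1 c z.
      by apply/funext => j; apply/funext => k; exact: g1_hom.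
    have -> : g2 c (hscale l z) = fun j k => l^-1 *: g2 c z j k.
      apply/funext => j; apply/funext => k; rewrite g2_hom// powR_inv1//.
      exact: ltW.
    rewrite /omega /= bil_scale !bilZl !bilZr ![in RHS]scalerDr; congr (_ + _).
    rewrite (scalerA l^-1) mulrC -scalerA; congr (_ *: _).
    by rewrite (scalerA l^-1) mulVf ?scale1r// gt_eqF.
  have e3 : 'D_(l `^ a *: hscale l u) (Z c) (hscale l z) =
      l `^ a *: (l `^ b *: 'D_u (Z c) z).
    exact: etrans (deriveE _ dlZ)
      (etrans e1 (congr1 (fun t => l `^ a *: (l `^ b *:
        t)) (esym (deriveE u dZ)))).
  have lab : l `^ (a + b) = l `^ a * l `^ b by apply: powRD;
    rewrite (gt_eqF l0) implybT.
  apply: (etrans (nabE X Z clz)).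
  rewrite (Xa c z l l0 cz) (Zb c z l l0 cz) (nabE X Z cz) lab -scalerA.
  apply: (etrans (f_equal2 +%R e3 e2)).
  by rewrite -!scalerDr.
Defined.

Lemma mk_connE c z : dom A c z ->
  gamma1 mk_conn c z = g1 c z /\ gamma2 mk_conn c z = g2 c z.
Proof. by move=> cz; apply: gamma_unique => // X Z; rewrite -nabE. Qed.

End construction.

(** * The maps of the theory *)

Section maps.
Context {R : realType} {n : nat} {M : manifold R n} {A : conic_dom M}.
Local Notation V := 'rV[R]_n.

(** Turns a law written in components into one for bilinear maps. H is the inhomogeneous term: the
    Hessian for anisotropic connections, 0 for tensors. *)
Lemma bil_jacobian c d z (T T' H : @array R n) : overlap A c d z ->
  (forall j k, 'd (trans c d) (z.1) (T j k) =
    \sum_b \sum_l (jac c d z.1 b j * jac c d z.1 l k) *: T' b l + H j k) ->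
  forall u w, 'd (trans c d) (z.1) (bil T u w) =
    bil T' ('d (trans c d) (z.1) u) ('d (trans c d) (z.1) w) + bil H u w.
Proof.
move=> zcd TT' u w; rewrite bil_linear; apply/esym.
pose J := 'd (trans c d) (z.1).
pose f u w := bil T' (J u) (J w) + bil H u w.
suff -> : bil (fun j k => J (T j k)) u w = f u w by [].
apply/esym/bil_ext.
- by move=> a v v' w'; rewrite /f (linearPZ J) !bilPl scalerDr addrACA.
- by move=> a v w' w''; rewrite /f (linearPZ J) !bilPr scalerDr addrACA.
- by move=> j k; rewrite /f bil_base TT'.
Qed.

Lemma canis_bil (G : anis_conn A) c d z u w : overlap A c d z ->
  'd (trans c d) (z.1) (bil (G c z) u w) =
    bil (G d (ntrans c d z)) ('d (trans c d) (z.1) u) ('d (trans c d) (z.1) w)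
    + bil (hess c d z.1) u w.
Proof.
by move=> zcd; apply: (bil_jacobian zcd) => j k; exact: canis_trans.
Qed.

Lemma tens_bil (T : htensor12 A) c d z u w : overlap A c d z ->
  'd (trans c d) (z.1) (bil (T c z) u w) =
    bil (T d (ntrans c d z)) ('d (trans c d) (z.1) u) ('d (trans c d) (z.1) w).
Proof.
move=> zcd.
have -> := bil_jacobian (H := fun _ _ => 0) (T := T c z) (T' :=
  T d (ntrans c d z)) zcd.
  by rewrite bil0T addr0.
by move=> j k; rewrite addr0; exact: tens_trans.
Qed.

Lemma jac_base (c d : chart M) (x : V) k :
  'd (trans c d) x (delta_mx 0 k) = \sum_l jac c d x l k *: delta_mx 0 l.
Proof. exact: row_sum_delta. Qed.

Lemma omega_suml (g1 g2 : @array R n) w (I : Type) (r : seq I) (a :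
  I -> R) (F : I -> V * V) :
  omega g1 g2 (\sum_(i <- r) a i *: F i) w = \sum_(i <- r) a i *:
    omega g1 g2 (F i) w.
Proof.
elim: r => [|i r IH]; first by rewrite !big_nil /omega !bil0l addr0.
by rewrite !big_cons omegaPl IH.
Qed.

Lemma omega_sumr (g1 g2 : @array R n) u (I : Type) (r : seq I) (a :
  I -> R) (F : I -> V) :
  omega g1 g2 u (\sum_(i <- r) a i *: F i) = \sum_(i <- r) a i *:
    omega g1 g2 u (F i).
Proof.
elim: r => [|i r IH]; first by rewrite !big_nil /omega !bil0r addr0.
by rewrite !big_cons omegaPr IH.
Qed.

(** A common form of two computations: U is either [delta_of N] or the vertical frame, and the
    Hessian term sees only its base component. *)
Lemma conn_form_frame_trans (D : lin_conn A) (U :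
  chart M -> V * V -> 'I_n -> V * V)
    c d z j k : overlap A c d z ->
  'd (ntrans c d) z (U c z j) = \sum_b jac c d z.1 b j *:
    U d (ntrans c d z) b ->
  'd (trans c d) (z.1) (conn_form D c z (U c z j) (ebase k)) =
  \sum_b \sum_l (jac c d z.1 b j * jac c d z.1 l k) *:
    conn_form D d (ntrans c d z) (U d (ntrans c d z) b) (ebase l)
  + bil (hess c d z.1) (U c z j).1 (ebase k).
Proof.
move=> zcd UE; rewrite conn_form_trans//; congr (_ + _).
rewrite UE /conn_form omega_suml; apply: eq_bigr => b _.
rewrite jac_base omega_sumr scaler_sumr; apply: eq_bigr => l _.
by rewrite scalerA.
Qed.

Lemma conn_form_delta (D : lin_conn A) c z (q : V) j w :
  conn_form D c z (ebase j, - q) w =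
  bil (gamma1 D c z) (ebase j) w - bil (gamma2 D c z) q w.
Proof. by rewrite /conn_form /omega /= bilNl. Qed.

Lemma smooth_delta (N : nonlin_conn A) c j :
  smooth_on (dom A c) (fun u => delta_of N c u j).
Proof.
have od : open (dom A c) by exact: open_dom.
by apply: smooth_pair => //; [exact: smooth_cst|apply: smoothN => //;
  exact: cnl_smooth].
Qed.

Definition jmath_val (N : nonlin_conn A) (D : lin_conn A) c z : @array R n :=
  fun j k => local_nabla D c z (fun u => delta_of N c u j) (fun=> ebase k).

Lemma jmath_valE N D c z j k : dom A c z ->
  jmath_val N D c z j k = conn_form D c z (delta_of N c z j) (ebase k).
Proof.
move=> cz; rewrite /jmath_val local_nablaE ?derive_cst ?add0r//.
- exact: smooth_delta.
- exact: smooth_cst.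
Qed.

Lemma cnl_homE (N : nonlin_conn A) c z l i : 0 < l -> dom A c z ->
  N c (hscale l z) i = l *: N c z i.
Proof.
move=> l0 cz; have /(congr1 snd)/= := cnl_hom N i l0 cz.
by rewrite scalerN => /oppr_inj.
Qed.

Lemma gamma_hscale (D : lin_conn A) c z l : 0 < l -> dom A c z ->
  gamma1 D c (hscale l z) = gamma1 D c z /\
  gamma2 D c (hscale l z) = fun j k => l^-1 *: gamma2 D c z j k.
Proof.
move=> l0 cz; split; apply/funext => j; apply/funext => k;
  first exact: gamma1_hom.
by rewrite gamma2_hom// powR_inv1// ltW.
Qed.

Definition jmathN (N : nonlin_conn A) (D : lin_conn A) : anis_conn A.
Proof.
refine (@CAnis _ _ _ _ (jmath_val N D) _ _ _ _).
- move=> c j k; apply: (@smooth_eq _ _ _ _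
    (fun z => conn_form D c z (delta_of N c z j) (ebase k))).
  + exact: open_dom.
  + by move=> z cz; rewrite jmath_valE.
  apply: omega_smooth.
  + exact: open_dom.
  + exact: gamma1_smooth.
  + exact: gamma2_smooth.
  + exact: smooth_delta.
  + exact: smooth_cst.
- by move=> c z j k cz; exact: local_nabla_out.
- move=> c d z j k zcd; rewrite jmath_valE; last exact: overlap_dom zcd.
  rewrite (conn_form_frame_trans D (U := delta_of N)) //; last exact: cnl_trans.
  rewrite /= bil_base; congr (_ + _).
  apply: eq_bigr => b _; apply: eq_bigr => l _; rewrite jmath_valE//.
  exact: dom_ntrans.
- move=> c z l j k l0 cz; rewrite !jmath_valE//; last exact: dom_hscale.
  (* The factor l from N cancels the l^-1 from [gamma2]. *)
  rewrite !conn_form_delta cnl_homE//; have [-> ->] := gamma_hscale D l0 cz.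
  by rewrite bil_scale bilZl scalerA mulVf ?gt_eqF// scale1r.
Defined.

Lemma jmathNE N D c z j k : dom A c z ->
  jmathN N D c z j k = gamma1 D c z j k - bil (gamma2 D c z) (N c z j) (ebase
    k).
Proof. by move=> cz; rewrite [LHS]jmath_valE// conn_form_delta bil_base. Qed.

Definition Delta_tensor (D : lin_conn A) : htensor12 A.
Proof.
refine (@Tens _ _ _ _ (gamma2 D) _ _ _ _).
- by move=> c j k; exact: gamma2_smooth.
- by move=> c z j k cz; exact: local_nabla_out.
- move=> c d z j k zcd; rewrite (conn_form_base D c z j k).2.
  rewrite (conn_form_frame_trans D (U := fun _ _ j => (0, ebase j))) //=.
    rewrite bil0l addr0; apply: eq_bigr => b _; apply: eq_bigr => l _.
    by rewrite (conn_form_base _ _ _ _ _).2.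
  apply: etrans (diff_ntrans _ (overlap_ncross zcd)) _ => /=.
  rewrite bil0l addr0 linear0 jac_base.
  elim: (index_enum _) => [|b r IH]; first by rewrite !big_nil.
  by rewrite !big_cons -IH; congr pair; rewrite /= ?scaler0 ?add0r.
- by move=> c z l j k; exact: gamma2_hom.
Defined.

(** Identifies [regmx] as the matrix of v |-> v + T(v, y); the transpose appears because vectors are
    rows. *)
Lemma regmxE (T : @array R n) (y v : V) : v + bil T v y = v *m (regmx T y)^T.
Proof.
apply/rowP => i; rewrite !mxE.
under [RHS]eq_bigr do rewrite !mxE mulrDr.
rewrite big_split /=; congr (_ + _).
  rewrite (bigD1 i)//= eqxx mulr1 big1 ?addr0// => j ji.
  by rewrite eq_sym (negbTE ji) mulr0.
rewrite /bil summxE; apply: eq_bigr => j _.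
rewrite summxE mulr_sumr; apply: eq_bigr => k _.
by rewrite !mxE mulrAC -mulrA.
Qed.

Lemma regmx_inj (T : @array R n) (y v w : V) : regmx T y \in unitmx ->
  v + bil T v y = w + bil T w y -> v = w.
Proof.
rewrite -unitmx_tr => Tu; rewrite !regmxE => e.
by rewrite -(mulmxK Tu v) e mulmxK.
Qed.

(** * The nonlinear connection of a regular connection *)

Section associated_nonlinear_connection.
Variable D : reg_lin_conn A.

Definition nl_val c z (i : 'I_n) : V :=
  if pselect (dom A c z) then
    \row_a \sum_b invmx (regmx (gamma2 D c z) z.2) a b *
      \sum_k gamma1 D c z i k 0 b * z.2 0 k
  else 0.

Lemma nl_valE c z i : dom A c z -> nl_val c z i =
    \row_a \sum_b invmx (regmx (gamma2 D c z) z.2) a b *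
      \sum_k gamma1 D c z i k 0 b * z.2 0 k.
Proof. by rewrite /nl_val; case: pselect. Qed.

(** Trades the inverse matrix for the linear equation that it solves. By regularity the solution is
    unique, so homogeneity and later comparisons are checked on the equation. *)
Lemma nl_valP c z i : dom A c z ->
  nl_val c z i + bil (gamma2 D c z) (nl_val c z i) z.2 =
  bil (gamma1 D c z) (ebase i) z.2.
Proof.
move=> cz; have Bu := creg_reg D cz.
have -> : nl_val c z i = bil (gamma1 D c z) (ebase i) z.2 *m
    (invmx (regmx (gamma2 D c z) z.2))^T.
  rewrite nl_valE//; apply/rowP => a; rewrite !mxE; apply: eq_bigr => b _.
  rewrite !mxE mulrC; congr (_ * _).
  by rewrite bil_basel summxE; apply: eq_bigr => k _; rewrite mxE mulrC.
by rewrite regmxE -mulmxA -trmx_mul mulmxV// trmx1 mulmx1.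
Qed.

Lemma nl_unique c z i v : dom A c z ->
  v + bil (gamma2 D c z) v z.2 = bil (gamma1 D c z) (ebase i) z.2 ->
  v = nl_val c z i.
Proof.
by move=> cz vE; apply: regmx_inj (creg_reg D cz) _; rewrite vE nl_valP.
Qed.

(* The value of the connection on the canonical section y of pi_A^*(TM): its
   kernel is the horizontal distribution of the associated nonlinear
   connection. *)
Let canon c z (u : V * V) : V := u.2 + conn_form D c z u z.2.

Let canon_delta c z i : dom A c z -> canon c z (delta_of nl_val c z i) = 0.
Proof.
move=> cz; rewrite /canon /delta_of conn_form_delta /= -nl_valP//.
by rewrite addrK addNr.
Qed.

Let canonP c z a u u' : canon c z (a *: u + u') = a *:
  canon c z u + canon c z u'.
Proof. by rewrite /canon /conn_form omegaPl /= [in RHS]scalerDr addrACA. Qed.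

(** The Hessian in the second component of the differential of [ntrans] is the one in the law of the
    connection form at w = y, so the two are absorbed. *)
Let canon_trans c d z u : overlap A c d z ->
  canon d (ntrans c d z) ('d (ntrans c d) z u) = 'd (trans c d) (z.1) (canon c
    z u).
Proof.
move=> zcd; have zn := overlap_ncross zcd.
rewrite /canon linearD (conn_form_trans D u z.2 zcd).
have e2 : ('d (ntrans c d) z u).2 = 'd (trans c d) (z.1) u.2 + bil (hess c d
  z.1) u.1 z.2.
  exact: (congr1 snd (diff_ntrans u zn)).
by rewrite e2 -addrA [bil (hess _ _ _ ) _ _ + _]addrC.
Qed.

Let canon_inj c z (u u' : V * V) : dom A c z -> u.1 = u'.1 ->
  canon c z u = 0 -> canon c z u' = 0 -> u = u'.
Proof.
case: u u' => p q [p' q'] cz /= <- ; rewrite /canon /conn_form /omega /=.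
rewrite addrCA => /(canRL (addKr _)); rewrite addr0 => h.
rewrite addrCA => /(canRL (addKr _)); rewrite addr0 => h'.
congr pair; apply: regmx_inj (creg_reg D cz) _.
by rewrite h h'.
Qed.

Definition assoc_nl : nonlin_conn A.
Proof.
refine (@CNl _ _ _ _ nl_val _ _ _ _).
- move=> c i; have od : open (dom A c) by exact: open_dom.
  have sy : smooth_on (dom A c) (fun z : V * V => z.2).
    by apply: smooth_snd => //; exact: smooth_id.
  apply: smooth_row => // a.
  apply: (@smooth_eq _ _ _ _ (fun z =>
    \sum_b invmx (regmx (gamma2 D c z) z.2) a b *
      \sum_k gamma1 D c z i k 0 b * z.2 0 k)) => //.
    by move=> z cz; rewrite nl_valE// mxE.
  apply: smooth_sum => // b _; apply: smoothM => //.
    apply: smooth_invmx => //; first exact: creg_reg.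
    move=> p q; apply: (@smooth_eq _ _ _ _ (fun z =>
      (p == q)%:R + \sum_k gamma2 D c z q k 0 p * z.2 0 k)) => //.
      by move=> z _; rewrite mxE.
    apply: smoothD => //; first exact: smooth_cst.
    apply: smooth_sum => // k _; apply: smoothM => //;
      apply: smooth_coord => //.
    exact: gamma2_smooth.
  apply: smooth_sum => // k _; apply: smoothM => //; apply: smooth_coord => //.
  exact: gamma1_smooth.
- by move=> c z i; rewrite /nl_val; case: pselect.
- move=> c d z i zcd; have cz := overlap_dom zcd; have dz := dom_ntrans zcd.
  (* Both sides of the law lie over the same base vector and in the kernel of [canon]. *)
  apply: (canon_inj dz).
  + apply: etrans (congr1 fst (diff_ntrans _ (overlap_ncross zcd))) _ => /=.
    rewrite jac_base; elim: (index_enum _) => [|b r IH];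
      first by rewrite !big_nil.
    by rewrite !big_cons IH.
  + by rewrite canon_trans// canon_delta// linear0.
  + elim: (index_enum _) => [|b r IH].
      by rewrite big_nil /canon /conn_form /omega !bil0l !addr0.
    by rewrite big_cons canonP IH canon_delta// scaler0 addr0.
- move=> c z l i l0 cz; rewrite /delta_of /hscale /= scalerN; congr (_, - _).
  (* At the scaled point l N solves the defining equation: [gamma1] is unchanged, [gamma2]
     contributes l^-1, and y contributes l. *)
  apply/esym; apply: nl_unique; first exact: dom_hscale.
  have [-> ->] := gamma_hscale D l0 cz;
    rewrite bil_scale /= bilZl !bilZr scalerA.
  by rewrite mulVf ?gt_eqF// scale1r -nl_valP// scalerDr.
Defined.

End associated_nonlinear_connection.
End maps.

(** * The embedding of anisotropic connections and the identifications *)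

Section identifications.
Context {R : realType} {n : nat} {M : manifold R n} {A : conic_dom M}.
Local Notation V := 'rV[R]_n.

Lemma assoc_nlP (D : reg_lin_conn A) c z i v : dom A c z ->
  assoc_nl D c z i = v <->
  v + bil (gamma2 D c z) v z.2 = bil (gamma1 D c z) (ebase i) z.2.
Proof.
move=> cz; split=> [<-|]; first exact: nl_valP.
by move/(nl_unique cz).
Qed.

Lemma jmathN_bil (N : nonlin_conn A) (D : lin_conn A) c z j w : dom A c z ->
  bil (jmathN N D c z) (ebase j) w =
  bil (gamma1 D c z) (ebase j) w - bil (gamma2 D c z) (N c z j) w.
Proof.
move=> cz; rewrite !bil_basel [X in bil (gamma2 D c z) _ X](row_sum_delta w)
  bil_sumr -sumrB.
apply: eq_bigr => k _; rewrite jmathNE// scalerBr; congr (_ - _).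
by rewrite bilZr.
Qed.

Section varrho.
Variable G : anis_conn A.

Let g2 : chart M -> V * V -> @array R n := fun _ _ _ _ => 0.

Definition varrho_conn : lin_conn A.
Proof.
refine (@mk_conn _ _ _ _ G g2 _ _ _ _ _).
- exact: canis_smooth.
- by move=> c j k; exact: smooth_cst.
- move=> c d z u w zcd; rewrite /omega !bil0T !addr0 canis_bil//.
  congr (bil _ _ _ + _); apply/esym.
  exact: (congr1 fst (diff_ntrans u (overlap_ncross zcd))).
- by move=> c z l j k; exact: canis_hom.
- by move=> c z l j k _ _; rewrite scaler0.
Defined.

Lemma varrho_connE c z : dom A c z ->
  gamma1 varrho_conn c z = G c z /\ gamma2 varrho_conn c z = fun _ _ => 0.
Proof. exact: mk_connE. Qed.

Definition varrho : reg_lin_conn A.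
Proof.
refine (@CReg _ _ _ _ varrho_conn _) => c z cz.
have [_ ->] := varrho_connE cz.
rewrite (_ : regmx _ _ = 1%:M) ?unitmx1//; apply/matrixP => i j.
by rewrite !mxE big1 ?addr0// => k _; rewrite ?mxE mul0r.
Defined.

Lemma assoc_nl_varrho c z i : dom A c z ->
  assoc_nl varrho c z i = bil (G c z) (ebase i) z.2.
Proof.
by move=> cz; apply/assoc_nlP => //; have [-> ->] := varrho_connE cz;
  rewrite bil0T addr0.
Qed.

Lemma jmathN_varrho N : jmathN N varrho = G.
Proof.
apply: canis_ext => c z j k cz; rewrite jmathNE//.
by have [-> ->] := varrho_connE cz; rewrite bil0T subr0.
Qed.

End varrho.

Lemma varrho_inj : injective varrho.
Proof.
move=> G H GH; apply: canis_ext => c z j k cz.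
by rewrite -(varrho_connE G cz).1 -(varrho_connE H cz).1 -/(varrho_conn H)
  -[varrho_conn H]/(creg_val (varrho H)) -GH.
Qed.

Section from_pair.
Variables (N : nonlin_conn A) (G : anis_conn A) (T : htensor12 A).

(** Inverts the formula of [jmathNE]: the correction makes the derivative along [delta_of N] have
    coefficients G. *)
Definition pair_gamma1 c z : @array R n :=
  fun j k => G c z j k + bil (T c z) (N c z j) (ebase k).

(** The vertical part of u in the splitting given by N, that is, what remains after subtracting the
    horizontal lift of u.1. *)
Let vert c z (u : V * V) : V := u.2 + \sum_j u.1 0 j *: N c z j.

Let omega_vert c z u w : omega (pair_gamma1 c z) (T c z) u w =
  bil (G c z) u.1 w + bil (T c z) (vert c z u) w.
Proof.
rewrite /omega /vert bilDl [bil (T _ _) u.2 w + _]addrC addrA; congr (_ + _).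
pose f p q := bil (G c z) p q + bil (T c z) (\sum_j p 0 j *: N c z j) q.
apply/esym; have := @bil_ext R n (pair_gamma1 c z) f; apply.
- move=> a p p' q; rewrite /f bilPl.
  have -> : \sum_j (a *: p + p') 0 j *: N c z j =
      a *: (\sum_j p 0 j *: N c z j) + \sum_j p' 0 j *: N c z j.
    rewrite scaler_sumr -big_split; apply: eq_bigr => j _.
    by rewrite !mxE scalerDl scalerA.
  by rewrite bilPl scalerDr addrACA.
- by move=> a p q q'; rewrite /f !bilPr scalerDr addrACA.
move=> j k; rewrite /f bil_base /pair_gamma1; congr (_ + bil _ _ _).
rewrite (bigD1 j)//= mxE !eqxx scale1r big1 ?addr0// => i ij.
by rewrite mxE (negbTE ij) andbF scale0r.
Qed.

Let vertP c z a u u' : vert c z (a *: u + u') = a *: vert c z u + vert c z u'.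
Proof.
rewrite /vert /= scalerDr addrACA; congr (_ + _).
rewrite scaler_sumr -big_split; apply: eq_bigr => j _.
by rewrite !mxE scalerDl scalerA.
Qed.

Let vert_delta c z j : vert c z (delta_of N c z j) = 0.
Proof.
rewrite /vert /= (bigD1 j)//= mxE !eqxx scale1r big1 ?addr0 ?addNr// => i ij.
by rewrite mxE (negbTE ij) andbF scale0r.
Qed.

Let vert_sum c z (I : Type) (r : seq I) (a : I -> R) (F : I -> V * V) :
  vert c z (\sum_(i <- r) a i *: F i) = \sum_(i <- r) a i *: vert c z (F i).
Proof.
elim: r => [|i r IH]; last by rewrite !big_cons vertP IH.
rewrite !big_nil /vert /= add0r big1// => j _.
by rewrite mxE scale0r.
Qed.

Let delta_vert c z (u : V * V) : u =
  \sum_j u.1 0 j *: delta_of N c z j + (0, vert c z u).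
Proof.
case: u => p q; rewrite /vert /=.
have -> : \sum_j p 0 j *: delta_of N c z j = (p, - \sum_j p 0 j *: N c z j).
  rewrite {2}(row_sum_delta p) -sumrN.
  elim: (index_enum _) => [|j r IH]; first by rewrite !big_nil.
  by rewrite !big_cons IH; congr pair; rewrite /= scalerN.
by congr pair; rewrite /= ?addr0// addrCA addNr addr0.
Qed.

(** Split u by N: the law of N sends horizontal vectors to horizontal ones, which [vert] kills, and
    vertical vectors transform by the Jacobian alone. *)
Let vert_trans c d z u : overlap A c d z ->
  vert d (ntrans c d z) ('d (ntrans c d) z u) = 'd (trans c d) (z.1) (vert c z
    u).
Proof.
move=> zcd; pose J := 'd (ntrans c d) z.
have vD w w' : vert d (ntrans c d z) (w + w') =
    vert d (ntrans c d z) w + vert d (ntrans c d z) w'.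
  by rewrite -[w in LHS]scale1r vertP scale1r.
have -> : 'd (ntrans c d) z u =
    \sum_j u.1 0 j *: J (delta_of N c z j) + J (0, vert c z u).
  rewrite {1}(delta_vert c z u) linearD linear_sum; congr (_ + _).
  by apply: eq_bigr => j _; exact: linearZZ.
rewrite vD vert_sum big1 ?add0r => [|j _].
  have -> : J (0, vert c z u) = (0, 'd (trans c d) (z.1) (vert c z u)).
    apply: etrans (diff_ntrans _ (overlap_ncross zcd)) _ => /=.
    by rewrite linear0 bil0l addr0.
  by move: (vert c z u) => v; rewrite /vert /= big1 ?addr0// => i _;
    rewrite mxE scale0r.
rewrite /J (cnl_trans N j zcd) vert_sum big1 ?scaler0// => i _.
by rewrite vert_delta scaler0.
Qed.

Definition pair_conn : lin_conn A.
Proof.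
refine (@mk_conn _ _ _ _ pair_gamma1 T _ _ _ _ _).
- move=> c j k; have od : open (dom A c) by exact: open_dom.
  apply: smoothD => //; first exact: canis_smooth.
  apply: smooth_bil => //; [exact: tens_smooth|exact: cnl_smooth|exact:
    smooth_cst].
- exact: tens_smooth.
- move=> c d z u w zcd; rewrite !omega_vert linearD canis_bil// tens_bil//.
  rewrite vert_trans// addrAC; congr (bil _ _ _ + _ + _); apply/esym.
  exact: (congr1 fst (diff_ntrans u (overlap_ncross zcd))).
- move=> c z l j k l0 cz; rewrite /pair_gamma1 canis_hom// cnl_homE//.
  have -> : T c (hscale l z) = fun j k => l^-1 *: T c z j k.
    by apply/funext => p; apply/funext => q; rewrite tens_hom// powR_inv1// ltW.
  by rewrite bil_scale bilZl scalerA mulVf ?gt_eqF// scale1r.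
- exact: tens_hom.
Defined.

Lemma pair_connE c z : dom A c z ->
  gamma1 pair_conn c z = pair_gamma1 c z /\ gamma2 pair_conn c z = T c z.
Proof. exact: mk_connE. Qed.

Lemma jmathN_pair_conn : jmathN N pair_conn = G.
Proof.
apply: canis_ext => c z j k cz; rewrite jmathNE//.
by have [-> ->] := pair_connE cz; rewrite addrK.
Qed.

Lemma Delta_pair_conn : Delta_tensor pair_conn = T.
Proof.
apply: tens_ext => c z j k cz; rewrite /=.
by have [_ ->] := pair_connE cz.
Qed.

End from_pair.

Lemma pair_conn_jmathN N (D : lin_conn A) :
  pair_conn N (jmathN N D) (Delta_tensor D) = D.
Proof.
apply: lin_conn_ext => c z cz;
  have [-> ->] := pair_connE N (jmathN N D) (Delta_tensor D) cz.
split=> //; apply/funext => j; apply/funext => k.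
by rewrite /pair_gamma1 jmathNE// subrK.
Qed.

(** The nonlinear connection must be known before the linear one is built, so it is taken from
    [varrho p.1]; [assoc_nl_identification] shows that the result has the same one. *)
Definition identification (p : anis_conn A * adm_htensor12 A) : reg_lin_conn A.
Proof.
refine (@CReg _ _ _ _ (pair_conn (assoc_nl (varrho p.1)) p.1 p.2) _) => c z cz.
have [_ ->] := pair_connE (assoc_nl (varrho p.1)) p.1 p.2 cz.
exact: tens_adm_P.
Defined.

Definition Delta_adm (D : reg_lin_conn A) : adm_htensor12 A :=
  @TensAdm _ _ _ _ (Delta_tensor D) (@creg_reg _ _ _ _ D).

Definition jmath (D : reg_lin_conn A) : anis_conn A := jmathN (assoc_nl D) D.

(** On y the coefficients of [jmath D] give Gamma1(e_i, y) - Gamma2(N_i, y), which is N_i by the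
    defining equation. *)
Lemma assoc_nl_jmath D : assoc_nl (varrho (jmath D)) = assoc_nl D.
Proof.
apply: cnl_ext => c z i cz; rewrite assoc_nl_varrho// jmathN_bil//.
by rewrite -(nl_valP _ _ cz) addrK.
Qed.

(** With N_i = Gamma(e_i, y), the equation to check is N_i + Delta(N_i, y) = Gamma1(e_i, y), and its
    right side is Gamma(e_i, y) + Delta(N_i, y) by construction of [pair_gamma1]. *)
Lemma assoc_nl_identification p :
  assoc_nl (identification p) = assoc_nl (varrho p.1).
Proof.
apply: cnl_ext => c z i cz; apply/assoc_nlP => //.
have N_i := assoc_nl_varrho p.1 i cz.
have [-> ->] := pair_connE (assoc_nl (varrho p.1)) p.1 p.2 cz.
rewrite N_i [in RHS]bil_basel.
under [RHS]eq_bigr do rewrite /pair_gamma1 N_i scalerDr.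
rewrite big_split /= -bil_basel; congr (_ + _).
rewrite [X in bil _ _ X](row_sum_delta z.2) bil_sumr.
by apply: eq_bigr => k _; rewrite bilZr.
Qed.

Lemma identificationK D : identification (jmath D, Delta_adm D) = D.
Proof.
apply: reg_lin_conn_ext; rewrite /= assoc_nl_jmath; exact: pair_conn_jmathN.
Qed.

Lemma jmath_identification p : jmath (identification p) = p.1.
Proof. by rewrite /jmath assoc_nl_identification; exact: jmathN_pair_conn. Qed.

Lemma Delta_identification p : Delta_adm (identification p) = p.2.
Proof. by apply: adm_htensor12_ext; exact: Delta_pair_conn. Qed.

End identifications.

Theorem theorem9 (R : realType) (n : nat) (M : manifold R n) (A : conic_dom M) :
  exists (rho : anis_conn A -> reg_lin_conn A)
    (jN : nonlin_conn A -> lin_conn A -> anis_conn A)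
    (Delta : lin_conn A -> htensor12 A) (nl : reg_lin_conn A -> nonlin_conn A)
    (Delta_reg : reg_lin_conn A -> adm_htensor12 A)
    (ident : anis_conn A * adm_htensor12 A -> reg_lin_conn A)
    (identN : nonlin_conn A -> anis_conn A * htensor12 A -> lin_conn A),
  let j : reg_lin_conn A -> anis_conn A := fun D => jN (nl D) D in
  (is_varrho rho /\ injective rho) /\
  (is_jmathN jN /\ is_Delta Delta /\ is_assoc_nl nl) /\
  (forall D : reg_lin_conn A, tens_adm_val (Delta_reg D) = Delta D) /\
  (cancel (fun D : reg_lin_conn A => (j D, Delta_reg D)) ident /\
   cancel ident (fun D : reg_lin_conn A => (j D, Delta_reg D))) /\
  (forall N : nonlin_conn A,
    cancel (fun D : lin_conn A => (jN N D, Delta D)) (identN N) /\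
    cancel (identN N) (fun D : lin_conn A => (jN N D, Delta D))) /\
  forall (S : reg_lin_conn A -> R) (S0 : anis_conn A -> R),
    let Sanis : anis_conn A -> R := fun G => S (rho G) in
    let S1 : reg_lin_conn A -> R := fun D => S0 (j D) in
    let Smod : reg_lin_conn A -> R := fun D => Sanis (j D) in
    (forall G : anis_conn A, S1 (rho G) = S0 G) /\
    (forall (G : anis_conn A) (T : adm_htensor12 A) (T' : htensor12 A)
       (adm : admissible (tadd T T')),
       Smod (ident (G, TensAdm adm)) = Smod (ident (G, T))) /\
    (forall N : nonlin_conn A,
       let S2 : lin_conn A -> R := fun D => S0 (jN N D) in
       let Smod2 : lin_conn A -> R := fun D => S (rho (jN N D)) in
       (forall G : anis_conn A, S2 (rho G) = S0 G) /\
       (forall (G : anis_conn A) (T T' : htensor12 A),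
          Smod2 (identN N (G, tadd T T')) = Smod2 (identN N (G, T)))).
Proof.
exists varrho, jmathN, Delta_tensor, assoc_nl, Delta_adm, identification.
exists (fun N p => pair_conn N p.1 p.2) => j.
split.
  split; last exact: varrho_inj.
  by move=> G c z i k cz; have [-> ->] := varrho_connE G cz.
split.
  split; [by []|split; [by []|]].
  move=> D c z i a cz.
  by rewrite [LHS](congr1 (fun w : 'rV[R]_n => w 0 a) (nl_valE D i cz)) mxE.
split; first by [].
split.
  split=> [D|p]; first exact: identificationK.
  rewrite [p in RHS]surjective_pairing /j -(jmath_identification p).
  by rewrite Delta_identification.
split=> [N|S S0].
  split=> [D|[G T]]; first exact: pair_conn_jmathN.
  by rewrite /= jmathN_pair_conn Delta_pair_conn.
(* [jmathN_varrho] holds for every nonlinear connection, in particular for the one associated with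
   [varrho G]. *)
split; first by move=> G /=; congr S0; exact: jmathN_varrho.
split=> [G T T' adm /=|N].
  (* The modified functional depends on its argument only through j, which recovers the first
     component of the pair. *)
  have jE p : j (identification p) = p.1 by exact: jmath_identification.
  by rewrite !jE.
split=> [G|G T T'] /=; first by congr S0; exact: jmathN_varrho.
by rewrite !jmathN_pair_conn.
Qed.
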